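(* Let $d\ge1$ and let $\Xi\subseteq\mathbb{R}^d$ be discrete. For $b>0$ let $G_b$ be the (undirected) graph with vertex set $\Xi$ and with an edge between every pair of distinct centers at Euclidean distance at most $b$ from each other. Suppose that for every $b>0$ the graph $G_b$ is recurrent for simple symmetric random walk. Then for every $\alpha\in(0,\infty)$ there exists an $\mathcal{L}$-a.e. unique stable allocation of $\mathbb{R}^d$ to $\Xi$ with appetite $\alpha$; that is, a stable allocation exists, and any two stable allocations to $\Xi$ with appetite $\alpha$ agree $\mathcal{L}$-almost everywhere.
   Context: $|\cdot|$ is the Euclidean norm and $\mathcal{L}$ is Lebesgue measure (volume) on $\mathbb{R}^d$. Elements of $\mathbb{R}^d$ are called sites. A set $\Xi\subset\mathbb{R}^d$ is discrete if every bounded subset of $\mathbb{R}^d$ contains only finitely many of its elements; elements of $\Xi$ are called centers. A (possibly disconnected) locally finite graph is recurrent if simple symmetric random walk started from any vertex is recurrent (a walk at an isolated vertex being regarded as recurrent). An allocation of $\mathbb{R}^d$ to $\Xi$ with appetite $\alpha$ is a measurable function $\psi:\mathbb{R}^d\to\Xi\cup\{\infty,\Delta\}$ (where $\infty,\Delta$ are two extra symbols) such that $\mathcal{L}[\psi^{-1}(\Delta)]=0$ and $\mathcal{L}[\psi^{-1}(\xi)]\le\alpha$ for all $\xi\in\Xi$. The set $\psi^{-1}(\xi)$ is the territory of $\xi$. A center $\xi$ is sated if $\mathcal{L}[\psi^{-1}(\xi)]=\alpha$ and unsated otherwise. A site $x$ is claimed if $\psi(x)\in\Xi$ and unclaimed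 if $\psi(x)=\infty$. Stability: let $\xi$ be a center and $x$ a site with $\psi(x)\notin\{\xi,\Delta\}$. We say $x$ desires $\xi$ if $|x-\xi|<|x-\psi(x)|$ or $x$ is unclaimed. We say $\xi$ covets $x$ if $|x-\xi|<|x'-\xi|$ for some $x'\in\psi^{-1}(\xi)$, or $\xi$ is unsated. The pair $(x,\xi)$ is unstable for $\psi$ if $x$ desires $\xi$ and $\xi$ covets $x$. An allocation is stable if there are no unstable pairs. *)

(* Defs.v *)
From HB Require Import structures.
From mathcomp Require Import all_boot all_order all_algebra.
From mathcomp Require Import finmap.
From mathcomp Require Import all_classical all_reals all_analysis.

Set Implicit Arguments.
Unset Strict Implicit.
Unset Printing Implicit Defensive.

Import Order.TTheory GRing.Theory Num.Theory.
Import numFieldNormedType.Exports.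

Local Open Scope classical_set_scope.
Local Open Scope ring_scope.

(* R^d is d.-tuple R with the product (Borel) sigma-algebra of MathComp-Analysis.
   The norm that the library puts on row vectors is the sup norm, hence the
   explicit Euclidean distance. *)

Definition edist (R : realType) (d : nat) (x y : d.-tuple R) : R :=
  Num.sqrt (\sum_(i < d) (tnth x i - tnth y i) ^+ 2).

Definition ebounded (R : realType) (d : nat) (B : set (d.-tuple R)) : Prop :=
  exists r : R, forall x, B x -> edist x [tuple 0 | i < d] <= r.

Definition discrete_set (R : realType) (d : nat) (Xi : set (d.-tuple R)) : Prop :=
  forall B, ebounded B -> finite_set (B `&` Xi).

Section lebesgue_tuple_succ.
Context (R : realType) (n : nat).
Variable mu : {sigma_finite_measure set (n.-tuple R) -> \bar R}.

Let tcons (p : R * n.-tuple R) : n.+1.-tuple R := [the n.+1.-tuple R of p.1 :: p.2].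

Let measurable_tcons : measurable_fun [set: R * n.-tuple R] tcons.
Proof. exact: measurable_cons. Qed.

Definition lebesgue_tuple_succ : set (n.+1.-tuple R) -> \bar R :=
  pushforward (@lebesgue_measure R \x mu)%E tcons.

Let succ0 : lebesgue_tuple_succ set0 = 0%E.
Proof. by rewrite /lebesgue_tuple_succ /pushforward preimage_set0 measure0. Qed.

Let succ_ge0 A : (0 <= lebesgue_tuple_succ A)%E.
Proof. exact: measure_ge0. Qed.

Let succ_sigma_additive : semi_sigma_additive lebesgue_tuple_succ.
Proof.
move=> F mF tF mUF; rewrite /lebesgue_tuple_succ /pushforward preimage_bigcup.
have mpre A : measurable A -> measurable (tcons @^-1` A).
  by move=> mA; rewrite -[X in measurable X]setTI; exact: measurable_tcons.
apply: measure_semi_sigma_additive.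
- by move=> k; exact: mpre.
- apply/trivIsetP => /= i j _ _ ij; rewrite -preimage_setI.
  by move/trivIsetP : tF => /(_ _ _ _ _ ij) ->//; rewrite preimage_set0.
- by rewrite -preimage_bigcup; exact: mpre.
Qed.

HB.instance Definition _ := isMeasure.Build _ _ _ lebesgue_tuple_succ
  succ0 succ_ge0 succ_sigma_additive.

Let succ_sigma_finite : sigma_finite setT lebesgue_tuple_succ.
Proof.
have [F TF Foo] := @sigma_finiteT _ _ _ (@lebesgue_measure R).
have [G TG Goo] := @sigma_finiteT _ _ _ mu.
pose H (p : nat * nat) : set (n.+1.-tuple R) :=
  [set x | F p.1 (thead x) /\ G p.2 [tuple of behead x]].
have mthead : measurable_fun [set: n.+1.-tuple R] (fun x => thead x).
  exact: measurable_tnth.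
have mH p : measurable (H p).
  apply: measurableI.
    rewrite -[X in measurable X]setTI; apply: mthead => //.
    exact: (Foo p.1).1.
  rewrite -[X in measurable X]setTI; apply: measurable_behead => //.
  exact: (Goo p.2).1.
exists (fun k => H (odflt (0, 0)%N (@choice.unpickle (nat * nat)%type k))).
  rewrite predeqE => x; split => // _.
  have : [set: R] (thead x) by [].
  rewrite TF => -[i _ Fi].
  have : [set: n.-tuple R] [tuple of behead x] by [].
  rewrite TG => -[j _ Gj].
  by exists (choice.pickle (i, j)) => //=; rewrite choice.pickleK.
move=> k; split; first exact: mH.
set p := odflt _ _.
rewrite /lebesgue_tuple_succ /pushforward.
rewrite (_ : _ @^-1` _ = F p.1 `*` G p.2); last first.
  rewrite predeqE => -[a t] /=; rewrite /H /= theadE.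
  have tE : [tuple of behead (tcons (a, t))] = t :> n.-tuple R by exact: val_inj.
  by rewrite tE.
have [mF Flt] := Foo p.1; have [mG Glt] := Goo p.2.
by rewrite product_measure1E// lte_mul_pinfty// ge0_fin_numE.
Qed.

HB.instance Definition _ := Measure_isSigmaFinite.Build _ _ _ lebesgue_tuple_succ
  succ_sigma_finite.

End lebesgue_tuple_succ.

(* Lebesgue measure on R^d as the d-fold product of the one-dimensional one. *)
Fixpoint lebesgue_tuple (R : realType) (d : nat) :
    {sigma_finite_measure set (d.-tuple R) -> \bar R} :=
  match d with
  | 0 => \d_[tuple]
  | n.+1 => lebesgue_tuple_succ (lebesgue_tuple R n)
  end.

Lemma lebesgue_tuple_box (R : realType) (d : nat) (A : 'I_d -> set R) :
  (forall i, measurable (A i)) ->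
  lebesgue_tuple R d [set x | forall i, A i (tnth x i)] =
    (\prod_(i < d) lebesgue_measure (A i))%E.
Proof.
elim: d A => [|n IH] A mA /=.
  by rewrite big_ord0 /dirac indicE mem_set// => -[].
rewrite big_ord_recl -IH => [|i]; last exact: mA.
rewrite /lebesgue_tuple_succ /pushforward.
rewrite -(product_measure1E _ (lebesgue_tuple R n)) //; last first.
  rewrite (_ : [set _ | _] =
      \bigcap_(i in [set: 'I_n]) ((@tnth n R)^~ i @^-1` A (lift ord0 i))).
    apply: fin_bigcap_measurable => // i _.
    by rewrite -[X in measurable X]setTI; apply: measurable_tnth.
  by rewrite predeqE => x; split => [H i _|H i]; exact: H.
  exact: mA.
rewrite (_ : preimage _ _ =
    A ord0 `*` [set x | forall i, A (lift ord0 i) (tnth x i)]) //.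
rewrite predeqE => -[a t]; split => /=.
  move=> H; split => [|i] /=; first exact: (H ord0).
  by have := H (lift ord0 i); rewrite tnthS.
move=> [Ha Ht] i; case: (unliftP ord0 i) => [j ->|-> //].
by rewrite tnthS; exact: Ht.
Qed.

Section simple_random_walk.
Context (R : realType) (T : choiceType).
Variables (V : set T) (E : T -> T -> Prop).

Definition neighbours (u : T) : set T := [set w | V w /\ E u w].

Definition degree (u : T) : nat := #|` fset_set (neighbours u)|%fset.

Definition step_prob (u w : T) : R :=
  if `[< neighbours u w >] then (degree u)%:R^-1 else 0.

(* The finite-dimensional distributions determine the law of the walk. *)
Definition is_srw (dO : measure_display) (O : measurableType dO)
    (P : probability O R) (v : T) (X : nat -> O -> T) : Prop :=
  [/\ forall n o, V (X n o),
      forall n u, measurable (X n @^-1` [set u]) &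
      forall n (u : nat -> T),
        P [set o | forall i, (i <= n)%N -> X i o = u i] =
          ((u 0%N == v)%:R * \prod_(i < n) step_prob (u i) (u i.+1))%:E].

(* Any two walks from v have the same law, so the choice of realization is
   immaterial. *)
Definition recurrent_from (v : T) : Prop :=
  exists (dO : measure_display) (O : measurableType dO)
    (P : probability O R) (X : nat -> O -> T),
    is_srw P v X /\ P [set o | exists n, X n.+1 o = v] = 1%E.

(* Intended for locally finite graphs: if neighbours v is infinite, then
   degree v is 0 and no walk starts from v. *)
Definition recurrent_graph : Prop :=
  forall v, V v -> neighbours v = set0 \/ recurrent_from v.

End simple_random_walk.

Definition dist_edge (R : realType) (d : nat) (b : R) (x y : d.-tuple R) : Prop :=
  x <> y /\ edist x y <= b.

Inductive label (T : Type) : Type :=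
| Center of T
| Infty
| Delta.
Arguments Infty {T}.
Arguments Delta {T}.

Section allocation.
Context (R : realType) (d : nat).
Variables (Xi : set (d.-tuple R)) (alpha : R).
Implicit Types (psi : d.-tuple R -> label (d.-tuple R)) (x xi : d.-tuple R).

Definition territory psi xi : set (d.-tuple R) := psi @^-1` [set Center xi].

(* Xi is countable, so Xi together with the two symbols carries the discrete
   sigma-algebra. *)
Definition allocation psi : Prop :=
  [/\ forall x xi, psi x = Center xi -> Xi xi,
      forall S, measurable (psi @^-1` S),
      lebesgue_tuple R d (psi @^-1` [set Delta]) = 0%E &
      forall xi, Xi xi -> (lebesgue_tuple R d (territory psi xi) <= alpha%:E)%E].

Definition sated psi xi : Prop :=
  lebesgue_tuple R d (territory psi xi) = alpha%:E.

Definition desires psi x xi : Prop :=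
  (exists2 eta, psi x = Center eta & edist x xi < edist x eta) \/ psi x = Infty.

Definition covets psi xi x : Prop :=
  (exists2 x', territory psi xi x' & edist x xi < edist x' xi) \/ ~ sated psi xi.

Definition unstable psi x xi : Prop :=
  [/\ Xi xi, psi x <> Center xi, psi x <> Delta, desires psi x xi &
      covets psi xi x].

Definition stable_allocation psi : Prop :=
  allocation psi /\ forall x xi, ~ unstable psi x xi.

End allocation.

(* Main.v *)
Require Import Defs.
From HB Require Import structures.
From mathcomp Require Import all_boot all_order all_algebra.
From mathcomp Require Import finmap.
From mathcomp Require Import all_classical all_reals all_analysis.
From mathcomp Require Import measurable_realfun.
From mathcomp Require Import ring lra.
Import Order.TTheory GRing.Theory Num.Theory.
Import numFieldNormedType.Exports.
Local Open Scope classical_set_scope.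
Local Open Scope ring_scope.

(* [edist] also names an extended-real distance of MathComp-Analysis. *)
Import Defs.

Set Implicit Arguments.
Unset Strict Implicit.
Unset Printing Implicit Defensive.

(* Existence. A stable allocation amounts to a family of radii rho : Xi -> [0, oo]
   such that, when each center xi accepts the sites at distance < rho xi and each
   site goes to the closest center accepting it, the volume received by xi is at
   most alpha, with equality if rho xi < oo. Raising rho xi helps xi and hurts
   the other centers, hence the pointwise infimum of all the families for which
   every center of finite radius receives at least alpha is such a family.

   Uniqueness. Given two stable allocations psi and phi, let A be the set of the
   sites that prefer psi, and read A as a flow that moves, for x in A, mass from
   phi x to psi x. By stability a center that receives flow sends out at least
   as much, and the phi-radius strictly decreases along the flow. So the flow
   that leaves a center v with positive mass stays in a graph of bounded range,
   and moreover the flow along an edge is at most the decrease of the volume of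
   the ball given by the phi-radius. Recurrence provides h of finite support with
   h v = 1 and arbitrarily small Dirichlet energy; testing the flow against h^2
   times a decreasing affine function of that volume bounds the mass that leaves
   v by a multiple of the energy of h. *)

(** * Limits in the extended reals; measures of finite and countable unions *)

Lemma cvge_le (R : realType) (u : nat -> \bar R) l c :
  u n @[n --> \oo] --> l -> (forall n, u n <= c)%E -> (l <= c)%E.
Proof.
move=> ul uc; rewrite -(cvg_lim _ ul)//.
by apply: lime_le; [exact: cvgP ul|exact: nearW].
Qed.

Lemma cvge_ge (R : realType) (u : nat -> \bar R) l c :
  u n @[n --> \oo] --> l -> (forall n, c <= u n)%E -> (c <= l)%E.
Proof.
move=> ul uc; rewrite -(cvg_lim _ ul)//.
by apply: lime_ge; [exact: cvgP ul|exact: nearW].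
Qed.

Section finite_unions.
Context d (T : measurableType d) (R : realType) (mu : {measure set T -> \bar R}).
Context (I : eqType).

Lemma measure_seq_le (s : seq I) (F : I -> set T) (B : set T) :
  (forall i, measurable (F i)) -> measurable B ->
  (forall x, B x -> exists2 i, i \in s & F i x) ->
  (mu B <= \sum_(i <- s) mu (F i))%E.
Proof.
move=> mF; elim: s B => [|i s IH] B mB BF.
  by rewrite big_nil (_ : B = set0) ?measure0//; apply/seteqP; split => // x /BF[].
rewrite big_cons -(setDUK (@subIsetl _ B (F i))).
have mBF := measurableI _ _ mB (mF i).
rewrite measureU//; last 2 first.
- exact: measurableD.
- by rewrite setDIK.
apply: leeD; first by apply: le_measure; rewrite ?inE//; exact: subIsetr.
apply: IH; first exact: measurableD.
move=> x [Bx nF]; have [j] := BF x Bx.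
by rewrite inE => /orP[/eqP-> Fx|js Fx]; [exfalso; apply: nF|exists j].
Qed.

Lemma measure_seq_ge (s : seq I) (F : I -> set T) (B : set T) :
  uniq s -> (forall i, measurable (F i)) -> measurable B ->
  (forall i x, i \in s -> F i x -> B x) ->
  (forall i j x, F i x -> F j x -> i = j) ->
  (\sum_(i <- s) mu (F i) <= mu B)%E.
Proof.
move=> + mF; elim: s B => [|i s IH] B; first by rewrite big_nil.
move=> /= /andP[si us] mB FB dF; rewrite big_cons.
have FiB : F i `<=` B by move=> x; apply: FB; rewrite mem_head.
rewrite -(setDUK FiB) measureU//; last 2 first.
- exact: measurableD.
- by rewrite setDIK.
apply: leeD => //; apply: IH => //; first exact: measurableD.
move=> j x js Fj; split; first by apply: FB Fj; rewrite inE js orbT.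
by move=> Fi; move: si; rewrite (dF _ _ _ Fi Fj) js.
Qed.

End finite_unions.

Section countable_unions.
Context d (T : measurableType d) (R : realType) (mu : {measure set T -> \bar R}).
Context (I : Type) (D : set I) (F : I -> set T).
Hypotheses (cD : countable D) (mF : forall i, D i -> measurable (F i)).

(** An injection of [D] into the naturals reindexes the family; numbers outside its image receive
    the empty set. *)
Let enum_countable : exists G : nat -> set T,
  \bigcup_(i in D) F i = \bigcup_n G n /\
  forall n, G n = set0 \/ exists2 i, D i & G n = F i.
Proof.
have /countable_injP[f injf] := cD.
exists (fun n => [set x | exists i, [/\ D i, f i = n & F i x]]); split.
  by apply/seteqP; split => x /= => [[i Di Fx]|[n _ [i [Di _ Fx]]]]; [exists (f i)|exists i] => //; exists i.
move=> n; have [[i [Di fi]]|H] := pselect (exists i, D i /\ f i = n).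
  right; exists i => //; apply/seteqP; split => x /=; last by exists i.
  move=> [j [Dj fj]]; suff -> : j = i by [].
  by apply: injf; rewrite ?inE// fj.
left; apply/seteqP; split => // x /= [i [Di fi _]]; by apply: H; exists i.
Qed.

Lemma bigcup_countable_measurable : measurable (\bigcup_(i in D) F i).
Proof.
have [G [-> GF]] := enum_countable; apply: bigcupT_measurable => n.
by have [->//|[i Di ->]] := GF n; exact: mF.
Qed.

Lemma bigcup_countable_null : (forall i, D i -> mu (F i) = 0%E) ->
  mu (\bigcup_(i in D) F i) = 0%E.
Proof.
move=> F0; have := bigcup_countable_measurable; have [G [-> GF]] := enum_countable => mG.
apply/negligibleP => //; apply: negligible_bigcup => n.
have [->|[i Di ->]] := GF n; first exact: negligible_set0.
by apply/negligibleP; [exact: mF|exact: F0].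
Qed.

End countable_unions.

(** * Hitting probabilities of the walk and their Dirichlet energy *)

Section hitting.
Context (R : realType) (T : choiceType) (V : set T) (E : T -> T -> Prop) (v : T).
Local Notation nbr := (neighbours V E).
Local Notation nb u := (fset_set (neighbours V E u)).

(* [hit n x] is the probability that the walk from [x] visits [v] within [n]
   steps, and [ret n x] that it does so at one of the times 1, ..., n + 1. *)
Fixpoint hit n x : R :=
  if x == v then 1 else
  if n is m.+1 then (degree V E x)%:R^-1 * \sum_(y <- nb x) hit m y else 0.

Definition ret n x : R := (degree V E x)%:R^-1 * \sum_(y <- nb x) hit n y.

Lemma hitv n : hit n v = 1.
Proof. by case: n => [|n] /=; rewrite eqxx. Qed.

Lemma hitS n x : x != v -> hit n.+1 x = ret n x.
Proof. by move=> /negPf /= ->. Qed.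

Lemma hit_ge0 n x : 0 <= hit n x.
Proof.
elim: n x => [|n IH] x /=; case: ifP => // _.
by rewrite mulr_ge0 ?invr_ge0// sumr_ge0.
Qed.

Lemma hit_homo n x : hit n x <= hit n.+1 x.
Proof.
elim: n x => [|n IH] x.
  by rewrite /=; case: ifP => // _; rewrite mulr_ge0 ?invr_ge0// sumr_ge0// => y _; case: ifP.
have [->|xv] := eqVneq x v; first by rewrite !hitv.
rewrite !hitS// /ret ler_wpM2l ?invr_ge0//; exact: ler_sum.
Qed.

Lemma hit_le_ret n x : x != v -> hit n x <= ret n x.
Proof. by move=> xv; rewrite -hitS// hit_homo. Qed.

Hypothesis cV : countable V.
Hypothesis fin_nbr : forall x, V x -> finite_set (nbr x).

Section walk.
Context (dO : measure_display) (O : measurableType dO) (P : probability O R).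
Variable X : nat -> O -> T.
Hypothesis srwX : is_srw V E P v X.

Definition cyl k (u : nat -> T) := [set o | forall i, (i <= k)%N -> X i o = u i].
Definition visit k n := [set o | exists m, [/\ (k < m)%N, (m <= k + n)%N & X m o = v]].

Lemma measurable_cyl k u : measurable (cyl k u).
Proof.
have [_ mX _] := srwX.
rewrite (_ : cyl k u = \bigcap_(i < k.+1) (X i @^-1` [set u i])).
  by apply: fin_bigcap_measurable => // i _; exact: mX.
by apply/seteqP; split => o /= H i ik; exact: (H i).
Qed.

Lemma measurable_visit k n : measurable (visit k n).
Proof.
have [_ mX _] := srwX.
rewrite (_ : visit k n = \bigcup_(m in [set m | (k < m)%N /\ (m <= k + n)%N]) (X m @^-1` [set v])).
  by apply: bigcup_measurable => // i _; exact: mX.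
by apply/seteqP; split => o /= [m]; [case=> *; exists m|case=> *; exists m].
Qed.

(** Only the values up to time [k.+1] matter: the extended path is used in cylinders of that
    length. *)
Definition ext k (u : nat -> T) y i := if (i <= k)%N then u i else y.

Lemma cyl_ext k u y : cyl k.+1 (ext k u y) = cyl k u `&` X k.+1 @^-1` [set y].
Proof.
apply/seteqP; split => o /=.
  move=> H; split => [i ik|]; last by rewrite H// /ext ltnn.
  by rewrite H ?leqW// /ext ik.
move=> [H Xy] i; rewrite leq_eqVlt => /orP[/eqP->|]; first by rewrite Xy /ext ltnn.
by rewrite ltnS => ik; rewrite H// /ext ik.
Qed.

(** The product formula for the finite-dimensional laws gains one factor. The Markov property enters
    in this form only. *)
Lemma prob_cyl_ext k u y :
  P (cyl k.+1 (ext k u y)) = (P (cyl k u) * (step_prob R V E (u k) y)%:E)%E.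
Proof.
have [_ _ fdd] := srwX.
rewrite /cyl !fdd -EFinM big_ord_recr /= -mulrA; congr (_ * (_ * _))%:E.
- by apply: eq_bigr => i _; rewrite /ext ltn_ord ltnW.
- by rewrite /ext leqnn ltnn.
Qed.

(** Total probability over the step after time [k]. Each step to a non-neighbour has probability 0,
    and countability of [V] makes their union [N] null. *)
Lemma prob_step_le k u (S : set O) (c : T -> R) : V (u k) ->
  measurable S -> S `<=` cyl k u ->
  (forall y, nbr (u k) y -> P (S `&` X k.+1 @^-1` [set y]) <=
     P (cyl k u) * ((degree V E (u k))%:R^-1 * c y)%:E)%E ->
  (P S <= P (cyl k u) * ((degree V E (u k))%:R^-1 * \sum_(y <- nb (u k)) c y)%:E)%E.
Proof.
have [XV mX _] := srwX.
move=> Vu mS Scyl Sy.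
have nbP y : y \in nb (u k) <-> nbr (u k) y.
  by rewrite in_fset_set ?inE//; exact: fin_nbr.
pose N := \bigcup_(y in V `\` nbr (u k)) cyl k.+1 (ext k u y).
have cD : countable (V `\` nbr (u k)) by apply: sub_countable cV; exact: subset_card_le.
have mN : measurable N.
  by apply: bigcup_countable_measurable => // i _; exact: measurable_cyl.
have N0 : P N = 0%E.
  apply: bigcup_countable_null => // y [_ /= ny]; first exact: measurable_cyl.
  by rewrite prob_cyl_ext /step_prob asboolF// mule0.
apply: (@le_trans _ _ (P (S `\` N))).
  rewrite (@measureDI _ _ _ P S N)//.
  rewrite [X in (_ + X)%E](_ : _ = 0%E) ?adde0//.
  by apply: (@subset_measure0 _ _ _ P _ N) => //; exact: measurableI.
apply: (@le_trans _ _ (\sum_(y <- nb (u k)) P (S `&` X k.+1 @^-1` [set y]))%E).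
  apply: measure_seq_le; [by move=> y; apply: measurableI|exact: measurableD|].
  move=> o [So No]; exists (X k.+1 o) => //; apply/nbP; apply: contrapT => nn.
  apply: No; exists (X k.+1 o) => //.
  by rewrite cyl_ext; split => //; exact: Scyl.
have Pfin : P (cyl k u) \is a fin_num by apply: fin_num_measure; exact: measurable_cyl.
have PE : P (cyl k u) = (fine (P (cyl k u)))%:E by rewrite fineK.
rewrite PE -EFinM 2!mulr_sumr -sumEFin !big_seq; apply: lee_sum => y ys.
by rewrite EFinM -PE; apply: Sy; exact/nbP.
Qed.

(** Induction on [n], conditioning on the next site [y]. If [y] is [v], the whole extended cylinder
    is the bound, as [hit] is 1 at [v]; otherwise the visit happens after time [k.+1], in a window
    shorter by one. *)
Lemma prob_visit_le k n u : V (u k) ->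
  (P (cyl k u `&` visit k n.+1) <= P (cyl k u) * (ret n (u k))%:E)%E.
Proof.
have [_ mX _] := srwX.
elim: n k u => [|n IH] k u Vu; rewrite /ret;
  apply: prob_step_le => //; try (by apply: measurableI;
    [exact: measurable_cyl|exact: measurable_visit]); move=> y uy;
  have stepE : step_prob R V E (u k) y = (degree V E (u k))%:R^-1
    by rewrite /step_prob asboolT.
all: have Vy : V y by case: uy.
all: have mI j z : measurable (cyl k u `&` visit k j `&` X k.+1 @^-1` [set z])
  by apply: measurableI => //; apply: measurableI;
    [exact: measurable_cyl|exact: measurable_visit].
(* This leaves four goals: [y = v] and [y != v], first for the base case and then for the inductive
   case. *)
all: have [yv|yv] := eqVneq y v.
- rewrite yv hitv mulr1 -[X in (_ * X%:E)%E]stepE yv -prob_cyl_ext.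
  apply: le_measure; rewrite ?inE//; first exact: measurable_cyl.
  by rewrite cyl_ext => o [[]].
- rewrite [X in P X](_ : _ = set0) ?measure0 ?mule_ge0// ?lee_fin ?mulr_ge0 ?invr_ge0 ?hit_ge0//.
  apply/seteqP; split => // o [[_ [m [km mk Xm]]] /= Xk].
  move: yv; rewrite -Xk -Xm (_ : m = k.+1) ?eqxx//.
  by apply/eqP; rewrite eqn_leq km -addn1 mk.
- rewrite yv hitv mulr1 -[X in (_ * X%:E)%E]stepE yv -prob_cyl_ext.
  apply: le_measure; rewrite ?inE//; first exact: measurable_cyl.
  by rewrite cyl_ext => o [[]].
- rewrite hitS// EFinM muleA -stepE -prob_cyl_ext.
  have := IH k.+1 (ext k u y); rewrite (_ : ext k u y k.+1 = y) ?/ext ?ltnn//; move=> /(_ Vy); apply: le_trans.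
  apply: le_measure; rewrite ?inE//.
    by apply: measurableI; [exact: measurable_cyl|exact: measurable_visit].
  rewrite cyl_ext => o [[co [m [km mk Xm]]] Xk]; split => //.
  exists m; split => //; last by rewrite addSnnS.
  rewrite ltn_neqAle km andbT; apply/eqP => mE.
  by move: yv; rewrite -Xm -mE Xk eqxx.
Qed.
(** The events of a return within [n.+1] steps increase to an event of probability 1, and each has
    probability at most [ret n v] because the walk starts at [v] almost surely. *)
Lemma ret_gt (eps : R) : V v -> 0 < eps ->
  P [set o | exists n, X n.+1 o = v] = 1%E -> exists n, 1 - eps < ret n v.
Proof.
have [XV mX fdd] := srwX => Vv eps0 P1.
have P0 : P (cyl 0 (fun=> v)) = 1%E by rewrite /cyl fdd big_ord0 eqxx mulr1.
have mI n : measurable (cyl 0 (fun=> v) `&` visit 0 n.+1).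
  by apply: measurableI; [exact: measurable_cyl|exact: measurable_visit].
have retP n : (P (visit 0 n.+1) <= (ret n v)%:E)%E.
  have := @prob_visit_le 0 n (fun=> v) Vv; rewrite P0 mul1e; apply: le_trans.
  rewrite (@measureDI _ _ _ P _ (cyl 0 (fun=> v))); [|exact: measurable_visit|exact: measurable_cyl].
  rewrite [X in (X + _)%E](_ : _ = 0%E) ?add0e 1?setIC//.
  have C0 : P (~` cyl 0 (fun=> v)) = 0%E.
    by rewrite probability_setC ?P0 ?subee//; exact: measurable_cyl.
  apply: (@subset_measure0 _ _ _ P _ (~` cyl 0 (fun=> v))) => //.
  - by apply: measurableD; [exact: measurable_visit|exact: measurable_cyl].
  - by apply: measurableC; exact: measurable_cyl.
have UE : [set o | exists n, X n.+1 o = v] = \bigcup_n visit 0 n.+1.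
  apply/seteqP; split => o /=.
    by move=> [n Xn]; exists n => //; exists n.+1.
  by move=> [n _ [[|m] [m0 _ Xm]]] //; exists m.
have mV n : measurable (visit 0 n.+1) by exact: measurable_visit.
have := @nondecreasing_cvg_mu _ _ _ P (fun n => visit 0 n.+1) mV (bigcupT_measurable _ mV).
rewrite -UE => cvP; apply: contrapT => /forallNP H.
have {}cvP : {homo (fun n => visit 0 n.+1) : n m / (n <= m)%N >-> (n <= m)%O} ->
    P (visit 0 n.+1) @[n --> \oo] --> 1%E by rewrite -P1; exact: cvP.
have : (1%:E <= (1 - eps)%:E :> \bar R)%E.
  apply: (@cvge_le _ (fun n => P (visit 0 n.+1))).
    apply: cvP => n m nm; apply/subsetPset => o [i [i0 im Xi]].
    by exists i; split => //; exact: leq_trans im _.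
  by move=> n; rewrite (le_trans (retP n))// lee_fin leNgt; apply/negP/H.
by rewrite lee_fin; lra.
Qed.

End walk.

Lemma recurrent_ret (eps : R) : V v -> recurrent_from R V E v -> 0 < eps ->
  exists n, 1 - eps < ret n v.
Proof. by move=> Vv [dS [S [P [X [sX PX]]]]] e0; exact: (ret_gt sX Vv e0 PX). Qed.

Hypothesis symE : forall x y, E x y -> E y x.

(** One more time step enlarges the support by at most one layer of neighbours, and every vertex has
    finitely many of them. *)
Lemma hit_finite_support n : V v ->
  finite_set [set x | V x /\ hit n x != 0].
Proof.
move=> Vv; elim: n => [|n IH].
  apply: (@sub_finite_set _ _ [set v]) => // x /= [_].
  by case: ifPn => [/eqP -> //|]; rewrite eqxx.
apply: (@sub_finite_set _ _ ([set v] `|`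
    \bigcup_(y in [set x | V x /\ hit n x != 0]) nbr y)); last first.
  rewrite finite_setU; split => //; apply: bigcup_finite => // y [Vy _]; exact: fin_nbr.
move=> x [Vx hx]; have [->|xv] := eqVneq x v; first by left.
right; apply: contrapT => H; move: hx; rewrite hitS// /ret big_seq big1 ?mulr0 ?eqxx// => y.
rewrite in_fset_set; last exact: fin_nbr.
rewrite inE => -[Vy xy]; apply/eqP/negPn/negP => hy.
by apply: H; exists y => //; split => //; exact: symE.
Qed.

(* Discrete Green formula: away from [v], [hit n] is subharmonic. *)
Lemma hit_energy n (F : {fset T}) : V v -> v \in F -> (forall x, x \in F -> V x) ->
  (forall x, x \in F -> hit n x != 0 -> {subset nb x <= F}) ->
  \sum_(x <- F) \sum_(y <- F) (y \in nb x)%:R * (hit n x - hit n y) ^+ 2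
  <= 2 * (degree V E v)%:R * (1 - ret n v).
Proof.
move=> Vv vF FV nF; set h := hit n.
have nbP x y : x \in F -> (y \in nb x) = `[< nbr x y >].
  by move=> xF; rewrite in_fset_set//; exact/fin_nbr/FV.
have nbC x y : x \in F -> y \in F -> (y \in nb x) = (x \in nb y).
  move=> xF yF; rewrite !nbP//; apply/asboolP/asboolP => -[_ /symE ?]; split => //; exact: FV.
(* Symmetrization: [(a - b)^2 = a (a - b) + b (b - a)], and the two halves have equal sums after
   exchanging [x] and [y]. *)
have -> : \sum_(x <- F) \sum_(y <- F) (y \in nb x)%:R * (h x - h y) ^+ 2 =
    2 * \sum_(x <- F) \sum_(y <- F) (y \in nb x)%:R * (h x * (h x - h y)).
  rewrite mulr_natl mulr2n [X in _ + X]exchange_big /= -big_split /=.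
  rewrite big_seq [RHS]big_seq; apply: eq_bigr => x xF.
  rewrite -big_split big_seq [RHS]big_seq; apply: eq_bigr => y yF /=.
  by rewrite (nbC y x)//; ring.
rewrite -mulrA ler_pM2l//.
(* Where [h x] is nonzero, [F] contains all the neighbours of [x], so the sum over [F] is the full
   Laplacian at [x]. *)
have inner x : x \in F -> \sum_(y <- F) (y \in nb x)%:R * (h x * (h x - h y)) =
    h x * (degree V E x)%:R * (h x - ret n x).
  move=> xF; have [h0|h0] := eqVneq (h x) 0.
    by rewrite h0 !mul0r big1// => y _; rewrite !mul0r mulr0.
  have -> : \sum_(y <- F) (y \in nb x)%:R * (h x * (h x - h y)) =
      \sum_(y <- nb x) h x * (h x - h y).
    under eq_bigr do rewrite mulr_natl mulrb.
    rewrite -big_mkcond -big_filter; apply: perm_big; apply: uniq_perm => //.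
      exact: filter_uniq.
    move=> y; rewrite mem_filter; case: (boolP (y \in nb x)) => //= ynb.
    exact: (nF x).
  rewrite -mulr_sumr -mulrA; congr (_ * _).
  rewrite sumrB big_const_seq count_predT iter_addr_0 -/(degree V E x) /ret.
  (* Cancelling the degree requires it to be nonzero; at degree 0 both sides vanish. *)
  have [d0|d0] := eqVneq (degree V E x) 0%N; last first.
    by rewrite mulrBr mulrA divff ?pnatr_eq0// mul1r mulr_natl.
  rewrite d0 mulr0n mul0r sub0r; move/eqP: d0; rewrite /degree cardfs_eq0 => /eqP ->.
  by rewrite big_seq_fset0 oppr0.
(* The term at [v] is the announced bound; every other term is nonpositive by [hit_le_ret]. *)
rewrite big_seq (eq_bigr _ inner) -big_seq (big_rem v)//= /h hitv mul1r.
rewrite gerDl big_seq sumr_le0// => x; rewrite rem_filter//.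
rewrite mem_filter => /andP[/= xv _].
by rewrite mulr_ge0_le0 ?mulr_ge0 ?hit_ge0// subr_le0 hit_le_ret.
Qed.

End hitting.

(** * Flows along a decreasing potential in a recurrent graph *)

Section flow.
Context (R : realType) (T : choiceType) (V : set T) (E : T -> T -> Prop) (v : T).
Local Notation nbr := (neighbours V E).
Local Notation nb u := (fset_set (neighbours V E u)).
Hypotheses (cV : countable V) (fin_nbr : forall x, V x -> finite_set (nbr x)).
Hypothesis symE : forall x y, E x y -> E y x.

(* Testing the flow against [h ^+ 2 * (K - pot)], the loss of [pot] along an
   edge pays for the square of the flow in AM-GM. *)
Let edge_le (g D p K a b : R) : 0 <= g -> g <= D -> 0 <= p -> p <= K ->
  g * (a ^+ 2 * (p - D) - b ^+ 2 * p) <= K ^+ 2 * (a - b) ^+ 2.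
Proof.
move=> g0 gD p0 pK.
apply: (@le_trans _ _ (p ^+ 2 * (a - b) ^+ 2)); last first.
  by rewrite ler_wpM2r ?sqr_ge0// ler_sqr ?nnegrE// (le_trans p0).
(* This sum of nonnegative terms is exactly the difference of the two sides; [g <= D] gives the sign
   of the last one. *)
have : 0 <= (g * a - p * (a - b)) ^+ 2 + g * p * (a - b) ^+ 2 + g * a ^+ 2 * (D - g).
  apply: addr_ge0; first apply: addr_ge0; first exact: sqr_ge0.
    exact: mulr_ge0 (mulr_ge0 _ _) (sqr_ge0 _).
  by rewrite mulr_ge0 ?subr_ge0// mulr_ge0 ?sqr_ge0.
by move=> H; rewrite -subr_ge0 (le_trans H)// le_eqVlt; apply/orP; left; apply/eqP; ring.
Qed.

(** The mass [c] that leaves [v] is at most [K ^+ 2] times the energy of [hit n], and recurrence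
    makes this energy arbitrarily small as [n] varies. *)
Lemma recurrent_flow0 (g : T -> T -> R) (pot : T -> R) :
  V v -> recurrent_from R V E v ->
  (forall x y, 0 <= g x y) ->
  (forall x y, g x y != 0 ->
    [/\ V x, nbr x y, 0 <= pot y, pot x <= pot v & g x y <= pot x - pot y]) ->
  (forall x, V x -> \sum_(y <- nb x) g y x <= \sum_(y <- nb x) g x y) ->
  forall y, g v y = 0.
Proof.
move=> Vv recv g0 gP gdiv y0; apply/eqP/negPn/negP => gvy0.
(* With this [K] the weight [K - pot] is 1 at [v] and at least 1 wherever [pot] does not exceed
   [pot v]. *)
pose c := \sum_(y <- nb v) g v y; pose K := 1 + pot v.
have nbP x y : V x -> (y \in nb x) = `[< nbr x y >].
  by move=> Vx; rewrite in_fset_set//; exact: fin_nbr.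
have c0 : 0 < c.
  have [_ vy _ _ _] := gP _ _ gvy0.
  rewrite /c (big_rem y0) /=; last by rewrite nbP//; exact/asboolP.
  by rewrite ltr_pwDl ?sumr_ge0// lt_neqAle eq_sym gvy0 g0.
suff key n : c <= K ^+ 2 * (2 * (degree V E v)%:R * (1 - ret R V E v n v)).
  pose M := K ^+ 2 * (2 * (degree V E v)%:R).
  (* If [M] vanished, [key] would contradict [0 < c]. *)
  have M0 : 0 < M.
    rewrite lt_neqAle mulr_ge0 ?sqr_ge0 ?mulr_ge0// andbT; apply/negP => /eqP M0.
    by have := key 0%N; rewrite mulrA -/M -M0 mul0r leNgt c0.
  have [n rn] := recurrent_ret cV fin_nbr Vv recv (divr_gt0 c0 M0).
  have := key n; rewrite mulrA -/M leNgt -ltr_pdivlMl//.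
  by rewrite mulrC; move/negP; apply; lra.
set h := hit R V E v n.
have fC := hit_finite_support R fin_nbr symE n Vv.
set C := mkset _ in fC.
have fCn : finite_set (C `|` \bigcup_(x in C) nbr x).
  by rewrite finite_setU; split => //; apply: bigcup_finite => // x [Vx _]; exact: fin_nbr.
(* [F] is the support of [h] together with its neighbours, so that summation by parts over [F] has
   no boundary terms. *)
pose F := fset_set (C `|` \bigcup_(x in C) nbr x).
have FV x : x \in F -> V x.
  by rewrite in_fset_set// inE => -[[]//|[y _ []]].
have hv : h v = 1 by exact: hitv.
have vF : v \in F by rewrite in_fset_set// inE; left; split => //; rewrite -/h hv oner_eq0.
have nF x : x \in F -> h x != 0 -> {subset nb x <= F}.
  move=> xF hx y; rewrite nbP; last exact: FV.
  move=> /asboolP xy; rewrite in_fset_set// inE; right; exists x => //.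
  by split => //; exact: FV.
have sumF x (G : T -> R) : x \in F -> h x != 0 -> (forall y, G y != 0 -> y \in nb x) ->
    \sum_(y <- F) G y = \sum_(y <- nb x) G y.
  move=> xF hx G0; rewrite (bigID (fun y => y \in nb x)) /= [X in _ + X]big1 ?addr0; last first.
    by move=> y ynb; apply/eqP/negPn/negP => /G0; exact/negP.
  rewrite -big_filter; apply: perm_big; apply: uniq_perm => //; first exact: filter_uniq.
  by move=> y; rewrite mem_filter; case: (boolP (y \in nb x)) => //= /(nF x xF hx).
pose phi x := h x ^+ 2 * (K - pot x).
apply: (@le_trans _ _ (\sum_(x <- F) \sum_(y <- F) g x y * (phi x - phi y))); last first.
  apply: (@le_trans _ _ (K ^+ 2 * \sum_(x <- F) \sum_(y <- F)
      (y \in nb x)%:R * (h x - h y) ^+ 2)); last first.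
    by rewrite ler_wpM2l ?sqr_ge0//; exact: hit_energy.
  rewrite mulr_sumr; apply: ler_sum => x _; rewrite mulr_sumr; apply: ler_sum => y _.
  have [->|gn] := eqVneq (g x y) 0.
    by rewrite mul0r mulr_ge0 ?sqr_ge0// mulr_ge0 ?sqr_ge0.
  have [Vx xy py pxv gle] := gP _ _ gn.
  rewrite nbP// asboolT// mul1r /phi (_ : K - pot x = (K - pot y) - (pot x - pot y)); last by ring.
  apply: edge_le; rewrite // /K; last by rewrite gerBl.
  by have := g0 x y; lra.
(* Summation by parts: the test function is now weighted by the net outflow of each vertex. *)
have -> : \sum_(x <- F) \sum_(y <- F) g x y * (phi x - phi y) =
    \sum_(x <- F) phi x * (\sum_(y <- F) g x y - \sum_(y <- F) g y x).
  have -> : \sum_(x <- F) phi x * (\sum_(y <- F) g x y - \sum_(y <- F) g y x) =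
      \sum_(x <- F) \sum_(y <- F) g x y * phi x - \sum_(x <- F) \sum_(y <- F) g y x * phi x.
    rewrite -sumrB; apply: eq_bigr => x _; rewrite mulrBr !mulr_sumr.
    by congr (_ - _); apply: eq_bigr => y _; rewrite mulrC.
  rewrite [X in _ - X]exchange_big -sumrB; apply: eq_bigr => x _.
  by rewrite -sumrB; apply: eq_bigr => y _; rewrite mulrBr.
have outF x : x \in F -> h x != 0 -> \sum_(y <- F) g x y = \sum_(y <- nb x) g x y.
  by move=> xF hx; apply: sumF => // y /gP[Vx xy _ _ _]; rewrite nbP// asboolT.
have inF x : x \in F -> h x != 0 -> \sum_(y <- F) g y x = \sum_(y <- nb x) g y x.
  move=> xF hx; apply: sumF => // y /gP[Vy [Vx yx] _ _ _].
  by rewrite nbP// asboolT//; split => //; exact: symE.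
rewrite (big_rem v)//= outF ?hv ?oner_eq0//.
(* Nothing flows into [v]: a source has potential at most [pot v], and the potential drops strictly
   along an edge with positive flow. *)
rewrite [X in _ * (_ - X)]big1 ?subr0; last first.
  move=> y _; apply/eqP/negPn/negP => gn; have [_ _ _ pyv gle] := gP _ _ gn.
  by have := g0 y v; move: gn; rewrite eq_le => /nandP[/negP|/negP]; lra.
rewrite /phi hv expr1n mul1r (_ : K - pot v = 1) ?mul1r; last by rewrite /K; ring.
rewrite lerDl big_seq sumr_ge0// => x /mem_rem xF.
have [h0|hx] := eqVneq (h x) 0; first by rewrite h0 expr0n /= !mul0r.
(* Up to potential [pot v] the weight is positive and the net outflow nonnegative; above it no flow
   enters or leaves [x]. *)
have [pxv|pxv] := leP (pot x) (pot v).
  apply: mulr_ge0; last by rewrite subr_ge0 outF// inF//; apply: gdiv; exact: FV.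
  by rewrite mulr_ge0 ?sqr_ge0// /K; lra.
rewrite big1 ?sub0r; last first.
  by move=> y _; apply/eqP/negPn/negP => /gP[_ _ _]; rewrite leNgt pxv.
rewrite big1 ?oppr0 ?mulr0// => y _; apply/eqP/negPn/negP => gn.
by have [_ _ _ pyv gle] := gP _ _ gn; have := g0 y x; lra.
Qed.

End flow.

(** * Lebesgue measure by slices: level sets of separable functions and translations *)

Section euclid.
Context {R : realType}.
Local Notation mu d := (lebesgue_tuple R d).

Lemma lebesgue_tupleS n (S : set (n.+1.-tuple R)) :
  mu n.+1 S = (\int[lebesgue_measure]_a
     mu n [set t : n.-tuple R | S [the n.+1.-tuple R of a :: t]])%E.
Proof.
rewrite /= /lebesgue_tuple_succ /pushforward /product_measure1.
by apply: eq_integral => a _ /=; rewrite xsectionE.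
Qed.

(** Uniqueness of the product measure allows the head coordinate to be integrated first. *)
Lemma lebesgue_tupleS_swap n (S : set (n.+1.-tuple R)) : measurable S ->
  mu n.+1 S = (\int[mu n]_t
     lebesgue_measure [set a | S [the n.+1.-tuple R of a :: t]])%E.
Proof.
move=> mS; rewrite /= /lebesgue_tuple_succ /pushforward.
rewrite (@product_measure_unique _ _ _ _ _ _ _
  (product_measure2 lebesgue_measure (mu n))); last 2 first.
- by move=> A B mA mB; exact: product_measure2E.
- by rewrite -[X in measurable X]setTI; exact: measurable_cons.
rewrite /product_measure2 /=.
by apply: eq_integral => t _ /=; rewrite ysectionE.
Qed.

Lemma lebesgue_measure_shift (c : R) (A : set R) : measurable A ->
  pushforward lebesgue_measure (fun x : measurableTypeR R => x - c : measurableTypeR R) A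
  = lebesgue_measure A.
Proof.
have mf : measurable_fun setT (fun x : measurableTypeR R => x - c : measurableTypeR R).
  by apply: measurable_funB.
move=> mA; apply/esym.
apply: lebesgue_measure_unique => //= _ [[a b]] _ <-.
rewrite /pushforward (_ : _ @^-1` _ = `](a + c), (b + c)]%classic); last first.
  by apply/seteqP; split => x /=; rewrite !in_itv /= ltrBrDr lerBlDr.
rewrite !lebesgue_measure_itv /= !lte_fin ltrD2r.
by case: ifPn => // _; rewrite -!EFinB; congr EFin; rewrite opprD addrACA subrr addr0.
Qed.

Lemma ge0_integral_shift (c : R) (f : R -> \bar R) :
  measurable_fun setT f -> (forall x, 0 <= f x)%E ->
  (\int[@lebesgue_measure R]_x f (x - c)%R = \int[@lebesgue_measure R]_x f x)%E.
Proof.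
move=> mf f0.
have mg : measurable_fun setT (fun x : measurableTypeR R => x - c : measurableTypeR R).
  by apply: measurable_funB.
have := @ge0_integral_pushforward _ _ _ _ R _ mg lebesgue_measure setT f measurableT.
move=> /= <- //.
by apply: eq_measure_integral => //= A mA _; rewrite -(lebesgue_measure_shift c mA).
Qed.

Lemma measurable_sum_coord d (g : 'I_d -> R -> R) :
  (forall i, measurable_fun setT (g i)) ->
  measurable_fun setT (fun x : d.-tuple R => \sum_(i < d) g i (tnth x i)).
Proof.
move=> mg; apply: measurable_sum => i.
by apply: measurableT_comp => //; exact: measurable_tnth.
Qed.

(** On a line parallel to axis [i] the section is a level set of [g i], hence countable and null.
    Induction on the dimension strips the coordinates before [i]. Bisectors and spheres are both of
    this form. *)
Lemma level_set0 d (g : 'I_d -> R -> R) (i : 'I_d) (c : R) :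
  (forall i, measurable_fun setT (g i)) ->
  (forall c, countable [set t | g i t = c]) ->
  mu d [set x | \sum_(j < d) g j (tnth x j) = c] = 0%E.
Proof.
elim: d g i c => [g []//|n IH] g i c mg cg.
have mS : measurable [set x : n.+1.-tuple R | \sum_(j < n.+1) g j (tnth x j) = c].
  have := @measurable_sum_coord _ g mg measurableT [set c] (measurable_set1 c).
  by rewrite setTI.
have splt a (t : n.-tuple R) :
    \sum_(j < n.+1) g j (tnth [the n.+1.-tuple R of a :: t] j) =
    g ord0 a + \sum_(j < n) g (lift ord0 j) (tnth t j).
  by rewrite big_ord_recl; congr (_ + _); apply: eq_bigr => j _; rewrite tnthS.
case: (unliftP ord0 i) cg => [j ->|->] cg.
  rewrite lebesgue_tupleS integral0_eq// => a _.
  rewrite -(IH (fun j => g (lift ord0 j)) j (c - g ord0 a))//.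
  by congr (mu n _); apply/seteqP; split => t /=; rewrite splt;
    [move=> <-; rewrite addrAC subrr add0r|move=> ->; rewrite addrC subrK].
rewrite lebesgue_tupleS_swap// integral0_eq// => t _.
apply: countable_lebesgue_measure0.
rewrite (_ : mkset _ = [set a | g ord0 a = c - \sum_(j < n) g (lift ord0 j) (tnth t j)]).
  exact: cg.
by apply/seteqP; split => a /=; rewrite splt; [move=> <-; rewrite addrK|move=> ->; rewrite subrK].
Qed.

(** One coordinate at a time: the induction hypothesis recentres the tail, and translation
    invariance of the one-dimensional integral recentres the head. *)
Lemma sublevel_shift d (xi : 'I_d -> R) (c : R) :
  mu d [set x | \sum_(j < d) (tnth x j - xi j) ^+ 2 < c] =
  mu d [set x | \sum_(j < d) (tnth x j) ^+ 2 < c].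
Proof.
have msq (u : R) : measurable_fun setT (fun t : R => (t - u) ^+ 2).
  by apply: measurable_funX; apply: measurable_funB.
elim: d xi c => [|n IH] xi c.
  by rewrite (_ : mkset _ = [set x | \sum_(j < 0) (tnth x j) ^+ 2 < c])//;
     apply/seteqP; split => x /=; rewrite !big_ord0.
pose F (s : R) := mu n [set t : n.-tuple R | \sum_(j < n) (tnth t j) ^+ 2 < c - s ^+ 2].
rewrite !lebesgue_tupleS.
transitivity (\int[@lebesgue_measure R]_a F (a - xi ord0)%R)%E.
  apply: eq_integral => a _; rewrite /F -(IH (fun j => xi (lift ord0 j))).
  congr (mu n _); apply/funext => t; rewrite /mkset big_ord_recl ltrBrDl.
  by under eq_bigr do rewrite tnthS.
rewrite ge0_integral_shift//.
  apply: eq_integral => a _; rewrite /F.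
  congr (mu n _); apply/funext => t; rewrite /mkset big_ord_recl ltrBrDl.
  by under [in RHS]eq_bigr do rewrite tnthS.
have mB : measurable [set p : R * n.-tuple R | p.1 ^+ 2 + \sum_(j < n) tnth p.2 j ^+ 2 < c].
  have mf : measurable_fun setT
      (fun p : R * n.-tuple R => p.1 ^+ 2 + \sum_(j < n) tnth p.2 j ^+ 2).
    apply: measurable_funD; first exact: measurable_funX.
    apply: (@measurableT_comp _ _ _ _ _ _ (fun t : n.-tuple R => \sum_(j < n) tnth t j ^+ 2)) => //.
    by apply: (measurable_sum_coord (g := fun=> (fun t => t ^+ 2))) => i; exact: measurable_funX.
  rewrite (_ : mkset _ = setT `&` (fun p : R * n.-tuple R => p.1 ^+ 2 + \sum_(j < n) tnth p.2 j ^+ 2) @^-1` `]-oo, c[%classic).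
    exact: mf.
  by rewrite setTI; apply/seteqP; split => p /=; rewrite in_itv.
rewrite (_ : F = mu n \o xsection [set p : R * n.-tuple R | p.1 ^+ 2 + \sum_(j < n) tnth p.2 j ^+ 2 < c]).
  exact: measurable_fun_xsection.
apply/funext => a; rewrite /F /=; congr (mu n _).
by rewrite xsectionE; apply/seteqP; split => t /=; rewrite ltrBrDl.
Qed.
End euclid.

(** * Euclidean balls, spheres, bisectors and discrete sets *)

Section edist_theory.
Context {R : realType} {d : nat}.
Implicit Types (x y z xi eta : d.-tuple R).
Local Notation mu := (lebesgue_tuple R d).

Lemma edist_ge0 x y : 0 <= edist x y.
Proof. exact: sqrtr_ge0. Qed.

Lemma sqr_edist x y : edist x y ^+ 2 = \sum_(i < d) (tnth x i - tnth y i) ^+ 2.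
Proof. by rewrite sqr_sqrtr// sumr_ge0// => i _; exact: sqr_ge0. Qed.

Lemma edistC x y : edist x y = edist y x.
Proof. by rewrite /edist; under eq_bigr do rewrite -sqrrN opprB. Qed.

(* Spares the triangle inequality, at the price of a constant. *)
Lemma edist_le2 x y z r : edist x y <= r -> edist y z <= r -> edist x z <= 2 * r.
Proof.
move=> xy yz; have r0 := le_trans (edist_ge0 x y) xy.
rewrite -ler_sqr ?nnegrE ?edist_ge0 ?mulr_ge0// sqr_edist.
have : edist x y ^+ 2 + edist y z ^+ 2 <= r ^+ 2 + r ^+ 2.
  by rewrite lerD// ler_sqr// nnegrE edist_ge0.
rewrite !sqr_edist -big_split /= => H.
apply: (@le_trans _ _ (2 * \sum_(i < d)
    ((tnth x i - tnth y i) ^+ 2 + (tnth y i - tnth z i) ^+ 2))).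
  rewrite mulr_sumr; apply: ler_sum => i _.
  rewrite -subr_ge0 (_ : _ - _ = (tnth x i - 2 * tnth y i + tnth z i) ^+ 2) ?sqr_ge0//.
  by ring.
by rewrite exprMn; lra.
Qed.

Lemma measurable_edist xi : measurable_fun setT (fun x => edist x xi).
Proof.
apply: measurableT_comp; first by apply: continuous_measurable_fun; exact: sqrt_continuous.
apply: (measurable_sum_coord (g := fun i t => (t - tnth xi i) ^+ 2)) => i.
by apply: measurable_funX; apply: measurable_funB.
Qed.

Definition oball xi (r : R) := [set x | edist x xi < r].

Lemma measurable_oball xi r : measurable (oball xi r).
Proof.
have := measurable_fun_ltr (measurable_edist xi) (@measurable_cst _ _ _ _ setT r).
by move=> /(_ measurableT [set true]); rewrite setTI; apply.
Qed.

Lemma measurable_edist_lt xi eta : measurable [set x | edist x xi < edist x eta].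
Proof.
have := measurable_fun_ltr (measurable_edist xi) (measurable_edist eta).
by move=> /(_ measurableT [set true]); rewrite setTI; apply.
Qed.

Lemma measurable_sphere xi r : measurable [set x | edist x xi = r].
Proof. by have := measurable_edist xi measurableT (measurable_set1 r); rewrite setTI. Qed.

Lemma oball_shift xi eta r : mu (oball xi r) = mu (oball eta r).
Proof.
suff E zt : mu (oball zt r) =
    if r <= 0 then 0%E else mu [set x | \sum_(j < d) (tnth x j) ^+ 2 < r ^+ 2].
  by rewrite !E.
case: ifPn => r0.
  (* Passing to squares is valid for positive radii only; here the ball is empty although [r ^+ 2]
     may be positive. *)
  rewrite (_ : oball zt r = set0) ?measure0//; apply/seteqP; split => // x /=.
  by move=> /(le_lt_trans (edist_ge0 _ _)); rewrite ltNge r0.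
rewrite -ltNge in r0; rewrite -(sublevel_shift (tnth zt)); congr (mu _).
by apply/funext => x; rewrite /oball /mkset -sqr_edist ltr_sqr ?nnegrE ?edist_ge0// ltW.
Qed.

Lemma abs_coord_le x y i : `|tnth x i - tnth y i| <= edist x y.
Proof.
rewrite -(@ler_sqr _ `|_|) ?nnegrE ?edist_ge0// sqr_edist real_normK ?num_real//.
by rewrite (bigD1 i)//= lerDl sumr_ge0// => j _; exact: sqr_ge0.
Qed.

Lemma oball_fin xi r : (mu (oball xi r) < +oo)%E.
Proof.
pose A i : set R := `](tnth xi i - r), (tnth xi i + r)[%classic.
apply: (@le_lt_trans _ _ (mu [set x | forall i, A i (tnth x i)])).
  apply: le_measure; rewrite ?inE; first exact: measurable_oball.
    rewrite (_ : mkset _ = \bigcap_(i in [set: 'I_d]) ((@tnth d R)^~ i @^-1` A i)).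
      apply: fin_bigcap_measurable => // i _.
      by rewrite -[X in measurable X]setTI; apply: measurable_tnth => //; exact: measurable_itv.
    by apply/seteqP; split => x /= H i; [move=> _|]; exact: (H i).
  move=> x /= xr i; rewrite /A /= in_itv /= -ltr_distl.
  exact: le_lt_trans (abs_coord_le _ _ _) xr.
rewrite lebesgue_tuple_box; last by move=> i; exact: measurable_itv.
have : (\prod_(i < d) @lebesgue_measure R (A i))%E \is a fin_num.
  apply: prode_fin_num => i _; rewrite lebesgue_measure_itv /=.
  by case: ifPn.
by move=> /fin_numPlt/andP[].
Qed.

(** The difference of the squared distances is a separable function whose [i]-th term is affine with
    nonzero slope as soon as the centers differ in coordinate [i]. *)
Lemma bisector0 xi eta : xi <> eta -> mu [set x | edist x xi = edist x eta] = 0%E.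
Proof.
move=> xe; have [i ie] : exists i, tnth xi i <> tnth eta i.
  by apply: contrapT => H; apply: xe; apply: eq_from_tnth => i; apply: contrapT => ne; apply: H; exists i.
pose g j (t : R) := (t - tnth xi j) ^+ 2 - (t - tnth eta j) ^+ 2.
rewrite -(@level_set0 _ d g i 0).
- congr (mu _); apply/seteqP; split => x /=; rewrite /g big_split /= sumrN -!sqr_edist.
    by move=> ->; rewrite subrr.
  by move/eqP; rewrite subr_eq0 eqrXn2 ?edist_ge0// => /eqP.
- by move=> j; apply: measurable_funB; apply: measurable_funX; apply: measurable_funB.
- move=> c; apply: (@sub_countable _ _ _
    [set ((c + tnth eta i ^+ 2 - tnth xi i ^+ 2) / (2 * (tnth eta i - tnth xi i)))]).
    apply: subset_card_le => t /= <-; rewrite /g.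
    have : tnth eta i - tnth xi i != 0 by rewrite subr_eq0; apply/eqP => /esym.
    by move=> ?; field.
  exact: finite_set_countable.
Qed.

(** The squared distance is separable, and each of its terms takes a value at most twice. In
    dimension 0 the sphere of radius 0 would be the whole space, of mass 1. *)
Lemma sphere0 xi r : (0 < d)%N -> mu [set x | edist x xi = r] = 0%E.
Proof.
move=> d0; pose i := Ordinal d0.
pose g j (t : R) := (t - tnth xi j) ^+ 2.
apply: (@subset_measure0 _ _ _ mu _ [set x | \sum_(j < d) g j (tnth x j) = r ^+ 2]).
- exact: measurable_sphere.
- have := @measurable_sum_coord _ d g _ measurableT [set r ^+ 2] (measurable_set1 _).
  by rewrite setTI; apply => j; apply: measurable_funX; apply: measurable_funB.
- by move=> x /= <-; rewrite -sqr_edist.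
apply: (@level_set0 _ d g i).
- by move=> j; apply: measurable_funX; apply: measurable_funB.
- move=> c; apply: (@sub_countable _ _ _
    [set tnth xi i + Num.sqrt c; tnth xi i - Num.sqrt c]).
    apply: subset_card_le => t /= <-; rewrite /g sqrtr_sqr.
    by case: ger0P => _; [left|right]; ring.
  exact: finite_set_countable.
Qed.

Variable Xi : set (d.-tuple R).
Hypothesis dXi : discrete_set Xi.

Lemma discrete_finite_near x r : finite_set [set xi | Xi xi /\ edist x xi <= r].
Proof.
pose o : d.-tuple R := [tuple 0 | _ < d].
apply: (@sub_finite_set _ _ ([set xi | edist x xi <= r] `&` Xi)).
  by move=> xi [].
apply: dXi; exists (2 * Num.max (edist x o) r) => xi /= xr.
by apply: (@edist_le2 _ x); rewrite ?(edistC xi) le_max ?lexx ?xr ?orbT.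
Qed.

Lemma discrete_countable : countable Xi.
Proof.
pose o : d.-tuple R := [tuple 0 | _ < d].
rewrite (_ : Xi = \bigcup_(n in [set: nat]) [set xi | Xi xi /\ edist o xi <= n%:R]).
  apply: bigcup_countable => // n _.
  exact/finite_set_countable/discrete_finite_near.
apply/seteqP; split => [xi Xxi|xi [n _ []]//].
exists (Num.trunc (edist o xi)).+1 => //; split => //.
by rewrite ltW// truncnS_gt.
Qed.
(** The exceptional null set shared by existence and uniqueness. *)
Definition ties := \bigcup_(xi in Xi) \bigcup_(eta in Xi `\ xi)
  [set x | edist x xi = edist x eta].

Let countable_D1 xi : countable (Xi `\ xi).
Proof. by apply: sub_countable discrete_countable; exact: subset_card_le. Qed.

Let measurable_bisector xi eta : measurable [set x | edist x xi = edist x eta].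
Proof.
rewrite (_ : mkset _ = ~` ([set x | edist x xi < edist x eta] `|`
    [set x | edist x eta < edist x xi])).
  by apply/measurableC/measurableU; exact: measurable_edist_lt.
apply/seteqP; split => x /=; first by move=> ->; rewrite ltxx => -[].
by move=> /not_orP[/negP + /negP]; rewrite -!leNgt => xe ex; apply/le_anti; rewrite xe ex.
Qed.

Lemma measurable_ties : measurable ties.
Proof.
apply: bigcup_countable_measurable => [|xi _]; first exact: discrete_countable.
exact: bigcup_countable_measurable.
Qed.

Lemma ties0 : mu ties = 0%E.
Proof.
apply: bigcup_countable_null => [|xi _|xi _]; first exact: discrete_countable.
  exact: bigcup_countable_measurable.
apply: bigcup_countable_null => // eta [_ /= ne].
by apply: bisector0 => /esym.
Qed.

End edist_theory.

(** * Existence: minimal radii and the allocation that they define *)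

Lemma seq_argmin (R : realType) (I : eqType) (s : seq I) (f : I -> R) i0 :
  i0 \in s -> exists2 i, i \in s & forall j, j \in s -> f i <= f j.
Proof.
elim: s i0 => [//|a s IH] i0 _.
case: s IH => [_|b s IH]; first by exists a; rewrite ?mem_head// => j; rewrite inE => /eqP ->.
have [i is_ imin] := IH b (mem_head _ _).
have [ai|ia] := leP (f a) (f i).
  exists a; rewrite ?mem_head// => j; rewrite inE => /orP[/eqP->//|/imin].
  exact: le_trans.
exists i; first by rewrite inE is_ orbT.
by move=> j; rewrite inE => /orP[/eqP->|/imin//]; exact: ltW.
Qed.

Section existence.
Context (R : realType) (d : nat) (Xi : set (d.-tuple R)) (alpha : R).
Hypotheses (d0 : (0 < d)%N) (dXi : discrete_set Xi) (alpha0 : 0 < alpha).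
Local Notation mu := (lebesgue_tuple R d).
Implicit Types (rho : d.-tuple R -> \bar R) (x xi eta : d.-tuple R).

Definition avail rho xi := [set x | ((edist x xi)%:E < rho xi)%E].

(* The territory of [xi] when the center [xi] accepts exactly the sites at
   distance less than [rho xi] and every site goes to the closest center
   accepting it. *)
Definition cell rho xi := [set x | avail rho xi x /\
  forall eta, Xi eta -> eta <> xi -> avail rho eta x -> edist x xi < edist x eta].

Lemma measurable_avail rho xi : measurable (avail rho xi).
Proof.
rewrite /avail; case: (rho xi) => [r||].
- rewrite (_ : mkset _ = oball xi r); first exact: measurable_oball.
  by apply/seteqP; split => x /=; rewrite lte_fin.
- rewrite (_ : mkset _ = setT)//; apply/seteqP; split => x //= _; exact: ltry.
- by rewrite (_ : mkset _ = set0)//; apply/seteqP; split => x.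
Qed.

Lemma measurable_cell rho xi : measurable (cell rho xi).
Proof.
rewrite (_ : cell rho xi = avail rho xi `\` \bigcup_(eta in Xi `\ xi)
    (avail rho eta `\` [set x | edist x xi < edist x eta])).
  apply: measurableD; first exact: measurable_avail.
  apply: bigcup_countable_measurable.
    by apply: sub_countable (discrete_countable dXi); exact: subset_card_le.
  by move=> eta _; apply: measurableD; [exact: measurable_avail|exact: measurable_edist_lt].
apply/seteqP; split => x [ax H]; split => //.
  by move=> [eta [Xe /= ne] [ae]]; apply; exact: H.
move=> eta Xe ne ae; apply: contrapT => nlt; apply: H; exists eta => //.
Qed.

Lemma cell_mono rho rho' xi : (rho xi <= rho' xi)%E ->
  (forall eta, eta <> xi -> (rho' eta <= rho eta)%E) ->
  cell rho xi `<=` cell rho' xi.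
Proof.
move=> H1 H2 x [ax Hx]; split; first exact: lt_le_trans ax H1.
by move=> eta Xe ne ae; apply: Hx => //; exact: lt_le_trans ae (H2 _ ne).
Qed.

Lemma le_mu_cell rho rho' xi : (rho xi <= rho' xi)%E ->
  (forall eta, eta <> xi -> (rho' eta <= rho eta)%E) ->
  (mu (cell rho xi) <= mu (cell rho' xi))%E.
Proof.
move=> H1 H2; apply: le_measure; rewrite ?inE; try exact: measurable_cell.
exact: cell_mono.
Qed.

Definition saturating rho := forall xi, Xi xi -> (rho xi < +oo)%E ->
  (alpha%:E <= mu (cell rho xi))%E.

Definition radius xi := ereal_inf [set rho xi | rho in saturating].

Lemma saturating_ge0 rho xi : Xi xi -> saturating rho -> (0 <= rho xi)%E.
Proof.
move=> Xxi srho; rewrite leNgt; apply/negP => r0.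
have := srho xi Xxi (lt_trans r0 (ltry _)).
rewrite (_ : cell _ _ = set0) ?measure0 ?lee_fin ?leNgt ?alpha0//.
apply/seteqP; split => // x [/= /lt_trans /(_ r0)].
by rewrite lte_fin ltNge edist_ge0.
Qed.

Lemma radius_ge0 xi : Xi xi -> (0 <= radius xi)%E.
Proof. by move=> Xxi; apply/ereal_infP => _ [rho srho <-]; exact: saturating_ge0. Qed.

Lemma radius_le rho xi : saturating rho -> (radius xi <= rho xi)%E.
Proof. by move=> srho; apply: ereal_inf_lbound; exists rho. Qed.

Definition upd rho xi e eta := if eta == xi then e else rho eta.

Lemma updE rho xi e : upd rho xi e xi = e.
Proof. by rewrite /upd eqxx. Qed.

Lemma updNE rho xi e eta : eta <> xi -> upd rho xi e eta = rho eta.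
Proof. by move=> /eqP /negPf; rewrite /upd => ->. Qed.

(** For each [n] some saturating family has radius below [q n] at [xi], and by monotonicity its cell
    lies in [B n]. So every [B n] has volume at least [alpha], and this survives in the limit. *)
Lemma saturating_radius : saturating radius.
Proof.
move=> xi Xxi rlt; have r0 := radius_ge0 Xxi.
have [r rE] : exists r, radius xi = r%:E.
  by exists (fine (radius xi)); rewrite fineK// ge0_fin_numE.
pose q n := r + n.+1%:R^-1; pose B n := cell (upd radius xi (q n)%:E) xi.
have mB n : measurable (B n) by exact: measurable_cell.
have aB n : (alpha%:E <= mu (B n))%E.
  have : (radius xi < (q n)%:E)%E by rewrite rE lte_fin ltrDl invr_gt0.
  move=> /ereal_inf_lt[_ [rho srho <-]] rq.
  apply: le_trans (srho xi Xxi (lt_trans rq (ltry _))) _.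
  apply: le_mu_cell; first by rewrite updE ltW.
  by move=> eta ne; rewrite updNE//; exact: radius_le.
(* Continuity from above needs a member of finite measure. *)
have B0 : (mu (B 0%N) < +oo)%E.
  apply: le_lt_trans (oball_fin xi (q 0%N)); apply: le_measure; rewrite ?inE//.
    exact: measurable_oball.
  by move=> x [/=]; rewrite /avail /= updE lte_fin.
have ndB : {homo B : n m / (n <= m)%N >-> (m <= n)%O}.
  move=> n m nm; apply/subsetPset; apply: cell_mono => [|eta ne]; last by rewrite !updNE.
  by rewrite !updE lee_fin lerD2l lef_pV2 ?posrE// ler_nat.
have mIB : measurable (\bigcap_n B n) by exact: bigcapT_measurable.
have aI : (alpha%:E <= mu (\bigcap_n B n))%E.
  apply: (@cvge_ge _ (mu \o B)) => //.
  exact: nonincreasing_cvg_mu.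
have mS : measurable [set x | edist x xi = r] by exact: measurable_sphere.
(* The intersection of the [B n] may contain sites at distance exactly [r], which the strict
   inequality in [avail] excludes; they form a null sphere. *)
apply: (le_trans aI); rewrite -(measureU0 (measurable_cell radius xi) mS (sphere0 xi r d0)).
apply: le_measure; rewrite ?inE//.
  by apply: measurableU => //; exact: measurable_cell.
move=> x xB.
have xr : edist x xi <= r.
  rewrite leNgt; apply/negP => rx.
  have [n] := ltr_add_invr rx; apply/negP; rewrite -leNgt ltW//.
  by have [] := xB n I; rewrite /avail /= updE lte_fin.
have [|rlx] := eqVneq (edist x xi) r; first by right.
left; split; first by rewrite /avail /= rE lte_fin lt_neqAle rlx.
move=> eta Xe ne ae; have [_] := xB 0%N I; apply => //.
by rewrite /avail /= updNE.
Qed.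

(** Minimality: if the cell were larger than [alpha], a slightly smaller radius at [xi] would still
    give at least [alpha], and the lowered family would be saturating. *)
Lemma mu_cell_radius xi : Xi xi -> (mu (cell radius xi) <= alpha%:E)%E.
Proof.
move=> Xxi; rewrite leNgt; apply/negP => alt.
have r0 : (0 <= radius xi)%E := radius_ge0 Xxi.
(* The sequence [q] approaches [radius xi] strictly from below, whether that radius is finite or
   not. *)
have [q [qlt qhomo qsup]] : exists q : nat -> R,
    [/\ forall n, ((q n)%:E < radius xi)%E, {homo q : n m / (n <= m)%N >-> n <= m} &
      forall t : R, (t%:E < radius xi)%E -> exists n, t < q n].
  case: (radius xi) r0 => [r||//] _.
    exists (fun n => r - n.+1%:R^-1); split.
    - by move=> n; rewrite lte_fin ltrBlDr ltrDl invr_gt0.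
    - by move=> n m nm; rewrite lerD2l lerN2 lef_pV2 ?posrE// ler_nat.
    - by move=> t; rewrite lte_fin => /ltr_add_invr[n tn]; exists n; rewrite ltrBrDr.
  exists (fun n => n%:R); split.
  - by move=> n; exact: ltry.
  - by move=> n m; rewrite ler_nat.
  - move=> t _; exists (Num.trunc `|t|).+1.
    by apply: le_lt_trans (truncnS_gt _); exact: ler_norm.
pose B n := cell (upd radius xi (q n)%:E) xi.
have mB n : measurable (B n) by exact: measurable_cell.
have [n aB] : exists n, (alpha%:E <= mu (B n))%E.
  apply: contrapT => /forallNP H; move: alt; apply/negP; rewrite -leNgt.
  apply: (@cvge_le _ (mu \o B)); last by move=> n /=; rewrite leNgt; apply/negP => /ltW /H.
  rewrite (_ : cell radius xi = \bigcup_n B n).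
    apply: nondecreasing_cvg_mu => //; first exact: bigcupT_measurable.
    move=> n m nm; apply/subsetPset; apply: cell_mono => [|eta ne]; last by rewrite !updNE.
    by rewrite !updE lee_fin qhomo.
  apply/seteqP; split => x.
    move=> [ax Hx]; have [n xn] := qsup _ ax; exists n => //; split.
      by rewrite /avail /= updE lte_fin.
    by move=> eta Xe ne; rewrite /avail /= updNE//; exact: Hx.
  move=> [n _]; apply: cell_mono; first by rewrite updE ltW.
  by move=> eta ne; rewrite updNE.
(* Lowering the radius of [xi] can only enlarge the other cells. *)
have : saturating (upd radius xi (q n)%:E).
  move=> eta Xe; have [->|/eqP ne] := eqVneq eta xi; first by [].
  rewrite updNE// => /(saturating_radius Xe) /le_trans; apply; apply: le_mu_cell.
    by rewrite updNE.
  move=> zt _; have [->|/eqP nz] := eqVneq zt xi; first by rewrite updE ltW.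
  by rewrite updNE.
by move=> sat; have := radius_le xi sat; rewrite updE leNgt qlt.
Qed.

Lemma cell_inj rho xi eta x : Xi xi -> Xi eta ->
  cell rho xi x -> cell rho eta x -> xi = eta.
Proof.
move=> Xxi Xe [ax Hx] [ae He]; apply: contrapT => ne.
have /lt_trans := Hx eta Xe (nesym ne) ae.
by move=> /(_ _ (He xi Xxi ne ax)); rewrite ltxx.
Qed.

Definition cell_alloc x : label (d.-tuple R) :=
  if pselect (exists xi, Xi xi /\ cell radius xi x) is left H then Center (projT1 (cid H))
  else if `[< forall xi, Xi xi -> ~ avail radius xi x >] then Infty else Delta.

Lemma cell_alloc_center x xi :
  cell_alloc x = Center xi <-> Xi xi /\ cell radius xi x.
Proof.
rewrite /cell_alloc; case: pselect => [H|H].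
  case: cid => zt [Xz Hz] /=; split => [[<-]//|[Xxi Hxi]].
  by rewrite (cell_inj Xz Xxi Hz Hxi).
by split => [|Hx]; [case: ifP|exfalso; apply: H; exists xi].
Qed.

Lemma cell_alloc_infty x :
  cell_alloc x = Infty <-> (forall xi, Xi xi -> ~ avail radius xi x).
Proof.
rewrite /cell_alloc; case: pselect => [[xi [Xxi Hxi]]|H].
  case: cid => zt Hz /=; split => // H; exfalso.
  by case: Hxi => + _; exact: H.
by split => [|Hx]; [case: asboolP|rewrite asboolT].
Qed.

(** Among the finitely many accepting centers no farther than a given one, some [xi1] is closest.
    Since [x] is not in its cell, another accepting center lies at the same distance. *)
Lemma cell_alloc_tie x : cell_alloc x = Delta ->
  exists xi eta, [/\ Xi xi, Xi eta, xi <> eta & edist x xi = edist x eta].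
Proof.
move=> xD.
have nC xi : Xi xi -> ~ cell radius xi x.
  by move=> Xxi Hx; have /cell_alloc_center := conj Xxi Hx; rewrite xD.
have [xi0 [Xxi0 a0]] : exists xi, Xi xi /\ avail radius xi x.
  apply: contrapT => /forallNP H; have : cell_alloc x = Infty.
    by apply/cell_alloc_infty => xi Xxi ax; apply: (H xi).
  by rewrite xD.
pose C := [set xi | Xi xi /\ edist x xi <= edist x xi0] `&` [set xi | avail radius xi x].
have fC : finite_set C.
  by apply: sub_finite_set (discrete_finite_near dXi x (edist x xi0)) => xi [].
have C0 : xi0 \in fset_set C by rewrite in_fset_set// inE; split.
have [xi1] := seq_argmin (fun xi => edist x xi) C0.
rewrite in_fset_set// inE => -[[X1 le1] a1] min1.
have : ~ cell radius xi1 x by exact: nC.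
move=> H; apply: contrapT => nt; apply: H; split => // eta Xe ne ae.
rewrite lt_neqAle; apply/andP; split.
  by apply/eqP => ed; apply: nt; exists xi1, eta; split => //; exact: nesym.
have [le0|lt0] := leP (edist x eta) (edist x xi0); last exact: le_trans le1 (ltW lt0).
by apply: min1; rewrite in_fset_set// inE.
Qed.

Lemma measurable_cell_alloc S : measurable (cell_alloc @^-1` S).
Proof.
pose I := ~` \bigcup_(xi in Xi) avail radius xi.
have cXi := discrete_countable dXi.
have mI : measurable I.
  by apply: measurableC; apply: bigcup_countable_measurable => // xi _; exact: measurable_avail.
have mC D : D `<=` Xi -> measurable (\bigcup_(xi in D) cell radius xi).
  move=> DXi; apply: bigcup_countable_measurable => [|xi _]; last exact: measurable_cell.
  by apply: sub_countable cXi; exact: subset_card_le.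
(* The constant sets encode whether [S] contains [Infty] and whether it contains [Delta]. *)
have mif (P : Prop) (A : set (d.-tuple R)) : measurable A -> measurable (A `&` [set _ | P]).
  move=> mA; have [p|np] := pselect P.
    by rewrite (_ : mkset _ = setT) ?setIT//; apply/seteqP; split.
  by rewrite (_ : mkset _ = set0) ?setI0//; apply/seteqP; split.
have IE x : I x <-> cell_alloc x = Infty.
  split => [H|/cell_alloc_infty H]; last by move=> [xi Xxi]; exact: H.
  by apply/cell_alloc_infty => xi Xxi ax; apply: H; exists xi.
rewrite (_ : _ @^-1` _ = \bigcup_(xi in Xi `&` [set xi | S (Center xi)]) cell radius xi `|`
    I `&` [set _ | S Infty] `|`
    ~` (\bigcup_(xi in Xi) cell radius xi `|` I) `&` [set _ | S Delta]).
  apply: measurableU; first apply: measurableU.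
  - by apply: mC => xi [].
  - exact: mif.
  - by apply: mif; apply/measurableC/measurableU => //; exact: mC.
apply/seteqP; split => x /=.
  case E : (cell_alloc x) => [xi||] Sx.
  - by have /cell_alloc_center[Xxi Cx] := E; left; left; exists xi.
  - by left; right; split => //; apply/IE.
  - right; split => //; case; last by move=> /IE; rewrite E.
    by move=> [xi Xxi Cx]; have /cell_alloc_center := conj Xxi Cx; rewrite E.
move=> [[[xi [Xxi Sxi] Cx]|[/IE -> //]]|[nCI SD]].
  by have /cell_alloc_center -> := conj Xxi Cx.
case E : (cell_alloc x) => [xi||//]; exfalso; apply: nCI.
  by have /cell_alloc_center[Xxi Cx] := E; left; exists xi.
by right; apply/IE.
Qed.

Lemma territory_cell xi : Xi xi -> territory cell_alloc xi = cell radius xi.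
Proof.
move=> Xxi; apply/seteqP; split => x /=; first by move=> /cell_alloc_center[].
by move=> Cx; apply/cell_alloc_center.
Qed.

(** A site that desires [xi] is not accepted by it, so it lies at distance at least [radius xi].
    Hence that radius is finite, [xi] is sated, and its whole territory is closer than the site:
    [xi] does not covet it. *)
Lemma stable_cell_alloc : stable_allocation Xi alpha cell_alloc.
Proof.
split; [split|].
- by move=> x xi /cell_alloc_center[].
- exact: measurable_cell_alloc.
- apply: (@subset_measure0 _ _ _ mu _ (ties Xi)) => //.
  + exact: measurable_cell_alloc.
  + exact: measurable_ties.
  + move=> x /cell_alloc_tie[xi [eta [Xxi Xe ne xE]]].
    by exists xi => //; exists eta => //; split => // /esym.
  + exact: ties0.
- by move=> xi Xxi; rewrite territory_cell//; exact: mu_cell_radius.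
move=> x xi [Xxi nC nD des cov].
have nax : ~ avail radius xi x.
  move=> ax; case: des => [[eta /cell_alloc_center[Xe [ae He]] lt]|].
    have [ex|/eqP ne] := eqVneq eta xi; first by rewrite ex ltxx in lt.
    by have := He xi Xxi (nesym ne) ax; rewrite ltNge (ltW lt).
  by move=> /cell_alloc_infty /(_ xi Xxi).
move/negP : nax; rewrite -leNgt => rx.
case: cov => [[x' + lt]|].
  rewrite territory_cell// => -[/= ax' _].
  by have := lt_le_trans ax' rx; rewrite lte_fin ltNge (ltW lt).
apply; rewrite /sated territory_cell//; apply/eqP; rewrite eq_le mu_cell_radius//=.
apply: saturating_radius => //; exact: le_lt_trans rx (ltry _).
Qed.

End existence.

(** * Uniqueness: comparison of two stable allocations *)

Section uniqueness.
Context (R : realType) (d : nat) (Xi : set (d.-tuple R)) (alpha : R).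
Hypotheses (d0 : (0 < d)%N) (dXi : discrete_set Xi) (alpha0 : 0 < alpha).
Local Notation mu := (lebesgue_tuple R d).
Local Notation stable := (stable_allocation Xi alpha).
Implicit Types (psi phi : d.-tuple R -> label (d.-tuple R)) (x y xi eta zt : d.-tuple R).

Definition gain psi phi := [set x | exists2 xi, psi x = Center xi & desires phi x xi].

Lemma measurable_territory psi xi : stable psi -> measurable (territory psi xi).
Proof. by move=> [[_ + _ _] _]; exact. Qed.

Lemma measurable_gain psi phi : stable psi -> stable phi -> measurable (gain psi phi).
Proof.
move=> spsi sphi; have cXi := discrete_countable dXi.
have [[psiXi mpsi _ _] _] := spsi; have [[phiXi mphi _ _] _] := sphi.
rewrite (_ : gain psi phi = \bigcup_(xi in Xi) (territory psi xi `&`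
    (phi @^-1` [set Infty] `|`
     \bigcup_(eta in Xi) (territory phi eta `&` [set x | edist x xi < edist x eta])))).
  apply: bigcup_countable_measurable => // xi _.
  apply: measurableI; first exact: measurable_territory.
  apply: measurableU; first exact: mphi.
  apply: bigcup_countable_measurable => // eta _.
  by apply: measurableI; [exact: measurable_territory|exact: measurable_edist_lt].
apply/seteqP; split => x /=.
  move=> [xi px [[eta fx lt]|fx]]; exists xi; try (by apply: psiXi px); split => //; [right|by left].
  by exists eta => //; exact: phiXi fx.
move=> [xi Xxi [px [fx|[eta Xe [fx lt]]]]]; exists xi => //; first by right.
by left; exists eta.
Qed.

(** Since [x] desires [xi] under [phi], stability of [phi] forbids [xi] to covet [x]. *)
Lemma gain_not_covets psi phi x xi : stable psi -> stable phi ->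
  psi x = Center xi -> desires phi x xi ->
  sated alpha phi xi /\ forall y, territory phi xi y -> edist y xi <= edist x xi.
Proof.
move=> [[psiXi _ _ _] _] [_ sphi] px des.
have ncov : ~ covets alpha phi xi x.
  move=> cov; apply: (sphi x xi); split => //; first exact: psiXi px.
    by case: (des) => [[eta -> lt]|->//] [ex]; rewrite ex ltxx in lt.
  by case: (des) => [[eta -> lt]|->].
split; first by apply: contrapT => ns; apply: ncov; right.
by move=> y ty; rewrite leNgt; apply/negP => lt; apply: ncov; left; exists y.
Qed.

(** * The flow of mass from [phi] to [psi] *)

Section transfer.
Variables (psi phi : d.-tuple R -> label (d.-tuple R)).
Hypotheses (spsi : stable psi) (sphi : stable phi).
Local Notation A := (gain psi phi).
Let mA : measurable A := measurable_gain spsi sphi.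

(** A single site is enough, whatever the measure gained: stability is pointwise, and one site makes
    [gain_not_covets] available at [xi]. *)
Definition gains_at xi := exists x, psi x = Center xi /\ desires phi x xi.

Lemma gains_at_center xi : gains_at xi -> Xi xi.
Proof. by move=> [x [px _]]; have [[psiXi _ _ _] _] := spsi; exact: psiXi px. Qed.

Lemma gain_territoryP xi x : territory psi xi x -> A x -> desires phi x xi.
Proof. by rewrite /territory /= => px [eta]; rewrite px => -[<-]. Qed.

Lemma territory_fin xi : Xi xi -> (mu (territory phi xi) < +oo)%E.
Proof. by have [[_ _ _ le] _] := sphi => Xxi; exact: le_lt_trans (le xi Xxi) (ltry _). Qed.

(** The center [xi] receives exactly [alpha] from [phi] and at most [alpha] from [psi]. Outside [A],
    almost all of its [phi]-territory is kept by [psi]: a site [y] lost to a worse label would, by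
    [gain_not_covets] applied in both directions, lie on the sphere through [x]. *)
Lemma gain_mass_le xi : gains_at xi ->
  (mu (A `&` territory psi xi) <= mu (A `&` territory phi xi))%E.
Proof.
move=> gx; have Xxi := gains_at_center gx; have [x [px dx]] := gx.
have [satx ballx] := gain_not_covets spsi sphi px dx.
have [[psiXi mpsi psiD lepsi] _] := spsi; have [[phiXi mphi phiD lephi] _] := sphi.
have mtpsi := measurable_territory xi spsi; have mtphi := measurable_territory xi sphi.
pose N := psi @^-1` [set Delta] `|` ties Xi `|` [set y | edist y xi = edist x xi].
have mN : measurable N.
  apply: measurableU; first by apply: measurableU; [exact: mpsi|exact: measurable_ties].
  exact: measurable_sphere.
have mS : measurable [set y | edist y xi = edist x xi] by exact: measurable_sphere.
have N0 : mu N = 0%E.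
  rewrite measureU0//; last exact: sphere0.
    by rewrite measureU0 ?psiD//; [exact: measurable_ties|exact: ties0].
  by apply: measurableU; [exact: mpsi|exact: measurable_ties].
set I := territory psi xi `&` territory phi xi.
have mI : measurable I by exact: measurableI.
have cover : territory phi xi `<=` (A `&` territory phi xi) `|` I `|` N.
  move=> y fy; case E : (psi y) => [zt||]; last by right; left; left.
  - have [zx|zx] := pselect (zt = xi); first by left; right; rewrite zx in E.
    have Xz : Xi zt by exact: psiXi E.
    have [lt|lt|eq] := ltgtP (edist y zt) (edist y xi).
    + by left; left; split => //; exists zt => //; left; exists xi.
    + right; right; have dy : desires psi y xi by left; exists zt.
      have [_ bally] := gain_not_covets sphi spsi fy dy.
      by apply/le_anti; rewrite ballx// bally.
    + by right; left; right; exists zt => //; exists xi => //; split => // /esym.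
  - right; right; have dy : desires psi y xi by right.
    have [_ bally] := gain_not_covets sphi spsi fy dy.
    by apply/le_anti; rewrite ballx// bally.
have mAI : measurable (A `&` territory phi xi) by exact: measurableI.
have finI : mu I \is a fin_num.
  rewrite ge0_fin_numE//; apply: le_lt_trans (territory_fin Xxi).
  by apply: le_measure; rewrite ?inE//; exact: subIsetr.
have upper : (alpha%:E <= mu (A `&` territory phi xi) + mu I)%E.
  rewrite -satx; apply: (@le_trans _ _ (mu ((A `&` territory phi xi) `|` I `|` N))).
    by apply: le_measure; rewrite ?inE//; do 2 apply: measurableU => //.
  rewrite measureU0//; last exact: measurableU.
  rewrite measureU2//.
have lower : (mu (A `&` territory psi xi) + mu I <= alpha%:E)%E.
  apply: le_trans (lepsi xi Xxi); rewrite -measureU//.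
  + apply: le_measure; rewrite ?inE//; first by apply: measurableU => //; exact: measurableI.
    by move=> y [[]//|[]].
  + exact: measurableI.
  + apply/seteqP; split => // y [[Ay ty] [_ fy]].
    have := gain_territoryP ty Ay; rewrite /desires fy => -[[eta [<-]]|//].
    by rewrite ltxx.
(* The common part [I] has finite measure and cancels. *)
by have := le_trans lower upper; rewrite leeD2rE.
Qed.

(** The [phi]-radius. Under [gains_at xi] this real supremum is a genuine one: the territory is
    bounded, and it is nonempty because [xi] is sated and [alpha] is positive. *)
Definition reach xi := sup [set edist y xi | y in territory phi xi].

Lemma reach_ge xi y : gains_at xi -> territory phi xi y -> edist y xi <= reach xi.
Proof.
move=> [x [px dx]] ty; have [_ ball] := gain_not_covets spsi sphi px dx.
apply: ub_le_sup; last by exists y.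
by exists (edist x xi) => _ [z tz <-]; exact: ball.
Qed.

Lemma reach_le xi x : psi x = Center xi -> desires phi x xi -> reach xi <= edist x xi.
Proof.
move=> px dx; have [sat ball] := gain_not_covets spsi sphi px dx.
apply: ge_sup; last by move=> _ [z tz <-]; exact: ball.
have [t0|/set0P[y ty]] := eqVneq (territory phi xi) set0.
  by move: sat; rewrite /sated t0 measure0 => -[] /esym/eqP; rewrite gt_eqF.
by exists (edist y xi); exists y.
Qed.

(** The sites whose mass flows from [xi] to [zt]. *)
Definition moved zt xi := A `&` territory psi zt `&` territory phi xi.

Lemma measurable_moved zt xi : measurable (moved zt xi).
Proof. by apply: measurableI; [apply: measurableI => //|]; exact: measurable_territory. Qed.

(** The potential of the flow. By translation invariance it depends on [reach xi] only, so balls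
    around different centers can be compared. *)
Definition volume xi := fine (mu (oball xi (reach xi))).

Lemma volumeE xi eta : (volume xi)%:E = mu (oball eta (reach xi)).
Proof. by rewrite (oball_shift eta xi) fineK// ge0_fin_numE//; exact: oball_fin. Qed.

Lemma volume_mono xi eta : reach xi <= reach eta -> volume xi <= volume eta.
Proof.
move=> le; rewrite -lee_fin (volumeE xi eta) (volumeE eta eta).
apply: le_measure; rewrite ?inE; try exact: measurable_oball.
by move=> x /lt_le_trans; exact.
Qed.

Lemma movedP zt xi y : gains_at xi -> moved zt xi y ->
  [/\ gains_at zt, reach zt <= edist y zt, edist y zt < edist y xi & edist y xi <= reach xi].
Proof.
move=> gx [[Ay ty] fy]; have dy := gain_territoryP ty Ay.
split; [by exists y|exact: reach_le|by case: dy => [[eta]|]; rewrite fy// => -[<-]|exact: reach_ge].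
Qed.

(** By [movedP] the moved sites lie in the shell around [zt] between the radii [reach zt] and
    [reach xi]. *)
Lemma mu_moved_le zt xi y : gains_at xi -> moved zt xi y ->
  (mu (moved zt xi) <= (volume xi - volume zt)%:E)%E.
Proof.
move=> gx mz; have [_ l1 l2 l3] := movedP gx mz.
have mo := @measurable_oball R d zt.
have sub : oball zt (reach zt) `<=` oball zt (reach xi).
  by move=> x /lt_le_trans; apply; exact: le_trans l1 (le_trans (ltW l2) l3).
rewrite EFinB (volumeE xi zt) (volumeE zt zt).
apply: (@le_trans _ _ (mu (oball zt (reach xi) `\` oball zt (reach zt)))).
  apply: le_measure; rewrite ?inE; [exact: measurable_moved|exact: measurableD|].
  move=> x mx; have [_ k1 k2 k3] := movedP gx mx; split; first exact: lt_le_trans k2 k3.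
  by rewrite /oball /= ltNge k1.
rewrite measureD//; last exact: oball_fin.
by rewrite (_ : _ `&` _ = oball zt (reach zt))//; apply/setIidPr.
Qed.

Hypothesis hrec : forall b : R, 0 < b -> recurrent_graph R Xi (@dist_edge R d b).

(** Otherwise some center [v] gains positive mass and so, by [gain_mass_le], loses positive mass;
    but [recurrent_flow0] makes the flow out of [v] vanish. *)
Lemma gain0 : mu A = 0%E.
Proof.
have cXi := discrete_countable dXi.
have mAt f xi : stable f -> measurable (A `&` territory f xi).
  by move=> sf; apply: measurableI => //; exact: measurable_territory.
have [[psiXi _ _ _] _] := spsi; have [[phiXi _ _ _] _] := sphi.
have AE : A = \bigcup_(xi in Xi) (A `&` territory psi xi).
  apply/seteqP; split => x; last by move=> [xi _ []].
  by move=> [xi px dx]; exists xi; [exact: psiXi px|split => //; exists xi].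
apply: contrapT => A0.
have [v [Xv v0]] : exists v, Xi v /\ mu (A `&` territory psi v) <> 0%E.
  apply: contrapT => /forallNP H; apply: A0; rewrite AE; apply: bigcup_countable_null => // xi Xxi.
    exact: mAt.
  by apply: contrapT => n0; apply: (H xi).
have gv : gains_at v.
  have [e0|/set0P[x [Ax tx]]] := eqVneq (A `&` territory psi v) set0.
    by exfalso; apply: v0; rewrite e0 measure0.
  by exists x; split => //; exact: gain_territoryP.
have in0 : mu (A `&` territory phi v) != 0%E.
  apply/eqP => i0; apply: v0; apply/le_anti; rewrite measure_ge0 andbT -i0.
  exact: gain_mass_le.
(* Two centers that exchange a site within distance [reach v] of both are at most [2 * reach v]
   apart; adding 1 keeps [b] positive. *)
pose b := 2 * reach v + 1.
have [w0 [Aw0 tw0]] : A `&` territory phi v !=set0.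
  by apply/set0P; apply: contra in0 => /eqP ->; rewrite measure0.
have rv0 : 0 <= reach v := le_trans (edist_ge0 w0 v) (reach_ge gv tw0).
have b0 : 0 < b by rewrite /b; lra.
pose E := @dist_edge R d b.
have fin_nbr x : Xi x -> finite_set (neighbours Xi E x).
  by move=> _; apply: sub_finite_set (discrete_finite_near dXi x b) => y [Xy []].
have symE x y : E x y -> E y x by move=> [ne le]; split; [exact: nesym|rewrite edistC].
(* This set of centers is closed under the flow, and the flow that starts in it uses only edges of
   length at most [b]. *)
pose near_v x := gains_at x /\ reach x <= reach v.
have movedE x y w : near_v x -> moved y x w -> near_v y /\ neighbours Xi E x y.
  move=> [gx rx] mw; have [gy l1 l2 l3] := movedP gx mw; split.
    by split => //; exact: le_trans l1 (le_trans (ltW l2) (le_trans l3 rx)).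
  split; first exact: gains_at_center.
  split; first by move=> xy; rewrite xy ltxx in l2.
  apply: (@le_trans _ _ (2 * reach v)); last by rewrite /b; lra.
  apply: (@edist_le2 _ _ _ w); first by rewrite edistC (le_trans l3).
  exact: le_trans (ltW l2) (le_trans l3 rx).
have nbP x y : Xi x -> (y \in fset_set (neighbours Xi E x)) = `[< neighbours Xi E x y >].
  by move=> Xx; rewrite in_fset_set//; exact: fin_nbr.
have vnear : near_v v by [].
have cover x : near_v x -> (mu (A `&` territory phi x) <=
    \sum_(y <- fset_set (neighbours Xi E x)) mu (moved y x))%E.
  move=> Wx; apply: measure_seq_le => [y||]; [exact: measurable_moved|exact: mAt|].
  move=> w [Aw tw]; have [zt pw _] := Aw.
  have mw : moved zt x w by split.
  have [_ xz] := movedE _ _ _ Wx mw.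
  by exists zt => //; rewrite nbP ?asboolT//; exact: gains_at_center Wx.1.
pose g x y : R := if `[< near_v x >] then fine (mu (moved y x)) else 0.
have gE x y : near_v x -> (g x y)%:E = mu (moved y x).
  move=> Wx; rewrite /g asboolT// fineK// ge0_fin_numE//.
  apply: le_lt_trans (territory_fin (gains_at_center Wx.1)); apply: le_measure; rewrite ?inE.
  - exact: measurable_moved.
  - exact: measurable_territory.
  - exact: subIsetr.
have gN x y : g x y != 0 -> near_v x /\ exists w, moved y x w.
  rewrite /g; case: asboolP => [Wx|_]; last by rewrite eqxx.
  move=> g0; split => //; apply/set0P; apply: contra g0 => /eqP ->.
  by rewrite measure0.
have flow0 : forall y, g v y = 0.
  apply: (@recurrent_flow0 R _ Xi E v _ fin_nbr symE g volume) => //.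
  (* The site [w0] moves from [v] to a neighbour, so [v] is not isolated. *)
  - have [nv0|//] := hrec b0 Xv.
    have [zt pw _] := Aw0; have mw : moved zt v w0 by split.
    by have [_] := movedE _ _ _ vnear mw; rewrite nv0.
  - by move=> x y; rewrite /g; case: ifP => // _; exact: fine_ge0.
  - move=> x y /gN[Wx [w mw]]; have [Wy xy] := movedE _ _ _ Wx mw.
    split => //; [exact: gains_at_center Wx.1|exact: fine_ge0|exact: volume_mono Wx.2|].
    by rewrite -lee_fin gE//; exact: mu_moved_le Wx.1 mw.
  (* No flow enters a center outside [near_v]. At the others, inflow is at most the mass gained,
     which is at most the mass lost, which goes to neighbours. *)
  - move=> x Xx; have [Wx|nWx] := pselect (near_v x); last first.
      rewrite big1 => [|y _].
        by rewrite sumr_ge0// => y _; rewrite /g asboolF.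
      apply/eqP/negPn/negP => /gN[Wy [w mw]]; apply: nWx.
      by have [] := movedE _ _ _ Wy mw.
    rewrite -lee_fin -!sumEFin; under [leRHS]eq_bigr do rewrite gE//.
    apply: le_trans (cover x Wx); apply: le_trans (gain_mass_le Wx.1).
    apply: (@le_trans _ _ (\sum_(y <- fset_set (neighbours Xi E x)) mu (moved x y))%E).
      apply: lee_sum => y _; have [Wy|nWy] := pselect (near_v y); first by rewrite gE.
      by rewrite /g asboolF// measure_ge0.
    apply: measure_seq_ge => //.
    + by move=> y; exact: measurable_moved.
    + exact: mAt.
    + by move=> y w _ [].
    + by move=> y z w [_ fy] [_]; rewrite /territory /= fy => -[].
move/negP: in0; apply; rewrite eq_le measure_ge0 andbT.
apply: (le_trans (cover v vnear)); rewrite big1// => y _.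
by rewrite -gE// flow0.
Qed.

End transfer.

(** Where the two labels differ and neither is [Delta], the site prefers one of them or lies in
    [ties]. *)
Lemma stable_unique psi phi :
  (forall b : R, 0 < b -> recurrent_graph R Xi (@dist_edge R d b)) ->
  stable psi -> stable phi -> {ae mu, forall x, psi x = phi x}.
Proof.
move=> hrec spsi sphi.
have [[psiXi mpsi psiD _] _] := spsi; have [[phiXi mphi phiD _] _] := sphi.
apply: (@negligibleS _ _ _ mu (gain psi phi `|` gain phi psi `|` (psi @^-1` [set Delta] `|`
    phi @^-1` [set Delta]) `|` ties Xi)); last first.
  apply: negligibleU; last by apply/negligibleP; [exact: measurable_ties|exact: ties0].
  apply: negligibleU.
  - by apply: negligibleU; apply/negligibleP; try exact: measurable_gain; exact: gain0.
  - by apply: negligibleU; apply/negligibleP.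
move=> x /= ne.
case Ep : (psi x) => [xi||]; last by left; right; left.
- case Ef : (phi x) => [eta||]; last by left; right; right.
  + have [lt|lt|eq] := ltgtP (edist x xi) (edist x eta).
    * by left; left; left; exists xi => //; left; exists eta.
    * by left; left; right; exists eta => //; left; exists xi.
    * right; exists xi; first exact: psiXi Ep.
      exists eta => //; split; first exact: phiXi Ef.
      by move=> /= ex; apply: ne; rewrite Ep Ef ex.
  + by left; left; left; exists xi => //; right.
- case Ef : (phi x) => [eta||]; last by left; right; right.
  + by left; left; right; exists eta => //; right.
  + by exfalso; apply: ne; rewrite Ep Ef.
Qed.

End uniqueness.

Theorem theorem2 (R : realType) (d : nat) (hd : (1 <= d)%N)
    (Xi : set (d.-tuple R)) (hXi : discrete_set Xi)
    (hrec : forall b : R, 0 < b -> recurrent_graph R Xi (@dist_edge R d b))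
    (alpha : R) (halpha : 0 < alpha) :
  (exists psi, stable_allocation Xi alpha psi) /\
  (forall psi1 psi2,
     stable_allocation Xi alpha psi1 -> stable_allocation Xi alpha psi2 ->
     {ae lebesgue_tuple R d, forall x, psi1 x = psi2 x}).
Proof.
split; first by exists (cell_alloc Xi alpha); exact: stable_cell_alloc.
by move=> psi1 psi2; exact: stable_unique.
Qed.
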